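(* Consider the risk-averse multistage linear program $$ \begin{aligned} \min_{\boldsymbol{x}_t,\boldsymbol{y}_t}\quad & \rho_1\Big(\boldsymbol{c}_1^\top \boldsymbol{y}_1+\rho_{2|\boldsymbol{\omega}_1}\big(\boldsymbol{c}_2^\top \boldsymbol{y}_2+\cdots+\rho_{T|\boldsymbol{\omega}_{[T-1]}}(\boldsymbol{c}_T^\top \boldsymbol{y}_T)\big)\Big)\\ \text{s.t.}\quad & \boldsymbol{A}_t\boldsymbol{x}_t+\boldsymbol{B}_t\boldsymbol{x}_{t-1}+\boldsymbol{T}_t\boldsymbol{y}_t=\boldsymbol{d}_t,\quad 0\le \boldsymbol{x}_t\le\bar x_t,\quad 0\le\boldsymbol{y}_t\le\bar y_t,\quad t=1,\dots,T,\\ & \boldsymbol{x}_t,\boldsymbol{y}_t \text{ measurable with respect to } \boldsymbol{\omega}_{[t]}=(\boldsymbol{\omega}_1,\dots,\boldsymbol{\omega}_t),\quad t=1,\dots,T, \end{aligned} \tag{P} $$ with given initial state $\boldsymbol{x}_0=x_0$, polyhedral risk measures and stagewise independent, finitely supported noise, as specified in the context. Let $V_1,\dots,V_{T+1}$ be the primal value functions and $D_0,\dots,D_T$ the dual value functions defined in the context, and let $V^{\boxtimes}$ denote the coperspective of a function $V$. Then for every $t\in\{1,\dots,T\}$, every $\pi_t$ and every $\gamma_t\ge 0$, $$ D_t(\pi_t,\gamma_t)=-\inf_{\substack{\zeta_t+\psi_t\ge \pi_t\\ \zeta_t\ge 0}}\ \Big\{\bar x_t^\top\zeta_t+V_{t+1}^{\boxtimes}(\psi_t,\gamma_t)\Big\}.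 $$ In particular, $D_t$ is concave and positively homogeneous of degree $1$ in $(\pi_t,\gamma_t)$, and $-D_t$ is the one-sided Lipschitz regularization of $V_{t+1}^{\boxtimes}$ (in the sense defined in the context). Further, the optimal value of (P) is $$ \sup_{\pi_0}\ \pi_0^\top x_0+D_0(\pi_0,1). $$
   Context: Setting. $T\ge 1$ is the horizon. $\boldsymbol{\omega}_1,\dots,\boldsymbol{\omega}_T$ are independent random variables with finite support. For each $t\in\{1,\dots,T\}$ the support of $\boldsymbol{\omega}_t$ is indexed by $j\in\{1,\dots,N_t\}$, and the random data $(\boldsymbol{A}_t,\boldsymbol{B}_t,\boldsymbol{T}_t,\boldsymbol{c}_t,\boldsymbol{d}_t)$ are functions of $\boldsymbol{\omega}_t$, with real matrices and vectors $(A_{t,j},B_{t,j},T_{t,j},c_{t,j},d_{t,j})$ of compatible sizes as realizations. The constraints of (P) are required for every realization. The bounds $\bar x_t$ ($t=0,\dots,T$) and $\bar y_t$ ($t=1,\dots,T$) are deterministic finite nonnegative vectors. The initial state $x_0$ is deterministic with $0\le x_0\le\bar x_0$. All vector inequalities and maxima are componentwise. It is assumed that (P) has an optimal solution. Risk measures. For each $t$, $\mathcal{Q}_t$ is the convex hull of a finite nonempty set of probability vectors in $\mathbb{R}^{N_t}$, and the polyhedral risk measure $\rho_t$ of $\theta=(\theta_1,\dots,\theta_{N_t})$ is $\rho_t[\theta]=\max_{q\in\mathcal{Q}_t}\sum_j q_j\theta_j$. The conditional risk measure $\rho_{t|\boldsymbol{\omega}_{[t-1]}}$ applies $\rho_t$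 to the dependence on $\boldsymbol{\omega}_t$, with $\boldsymbol{\omega}_1,\dots,\boldsymbol{\omega}_{t-1}$ fixed. For $\gamma\ge 0$, $\gamma\mathcal{Q}_t=\{\gamma q: q\in\mathcal{Q}_t\}$. Primal value functions. $V_{T+1}\equiv 0$, and for $t=T,\dots,1$, $$ V_t(x)=\min_{(x_j,y_j)_{j\le N_t}}\ \rho_t\Big[\big(c_{t,j}^\top y_j+V_{t+1}(x_j)\big)_{j\le N_t}\Big] $$ subject to $A_{t,j}x_j+B_{t,j}x+T_{t,j}y_j=d_{t,j}$, $0\le x_j\le\bar x_t$, $0\le y_j\le\bar y_t$ and $V_{t+1}(x_j)<+\infty$ for all $j$. The value is $+\infty$ if the problem is infeasible. Dual value functions. $D_T(\pi_T,\gamma_T)=-\bar x_T^\top\max\{\pi_T,0\}$, and for $t=T-1,\dots,0$ and $\gamma_t\ge0$, $$ D_t(\pi_t,\gamma_t)=\sup_{\zeta,\gamma_j,\lambda_j,\pi_j,\xi_j}\ -\bar x_t^\top\zeta+\sum_{j=1}^{N_{t+1}}\Big[-d_{t+1,j}^\top\lambda_j-\bar y_{t+1}^\top\xi_j+D_{t+1}(\pi_j,\gamma_j)\Big] $$ subject to $(\gamma_j)_{j\le N_{t+1}}\in\gamma_t\mathcal{Q}_{t+1}$, $\ \zeta+\sum_{j}B_{t+1,j}^\top\lambda_j\ge\pi_t$, $\ \pi_j+A_{t+1,j}^\top\lambda_j=0$ for all $j$, $\ \gamma_jc_{t+1,j}+T_{t+1,j}^\top\lambda_j+\xi_j\ge0$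 for all $j$, $\ \xi_j\ge0$ for all $j$, and $\zeta\ge0$. Coperspective. For a proper lower semicontinuous convex function $f:\mathbb{R}^n\to(-\infty,+\infty]$ with Fenchel conjugate $f^\star(\psi)=\sup_x\psi^\top x-f(x)$, the coperspective $f^{\boxtimes}$ is the perspective of $f^\star$. That is, $f^{\boxtimes}(\psi,\gamma)=\gamma f^\star(\psi/\gamma)=\sup_{x\in\mathbb{R}^n}\psi^\top x-\gamma f(x)$ for $\gamma>0$, and $f^{\boxtimes}(\psi,0)$ is the recession function of $f^\star$ at $\psi$ (the lower semicontinuous extension to $\gamma=0$). One-sided Lipschitz regularization. For a function $W(\psi,\gamma)$ and the bound $\bar x_t$, this is the function $(\pi,\gamma)\mapsto\inf\{\bar x_t^\top\zeta+W(\psi,\gamma):\ \zeta+\psi\ge\pi,\ \zeta\ge0\}$. *)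

(* Defs.v *)
From HB Require Import structures.
From mathcomp Require Import all_boot all_order all_algebra.
From mathcomp Require Import all_classical all_reals all_analysis.

Set Implicit Arguments.
Unset Strict Implicit.
Unset Printing Implicit Defensive.

Import Order.TTheory GRing.Theory Num.Theory.
Import numFieldNormedType.Exports.

Local Open Scope classical_set_scope.
Local Open Scope ring_scope.

Definition dot (R : realType) n (u v : 'cV[R]_n) : R := (u^T *m v) 0 0.

Definition vle (R : realType) n (u v : 'cV[R]_n) : Prop :=
  forall i, u i 0 <= v i 0.

Notation "u <=v v" := (vle u v) (at level 70, no associativity) : ring_scope.

Definition pospart (R : realType) n (u : 'cV[R]_n) : 'cV[R]_n :=
  map_mx (Num.max 0) u.

Definition prob_vector (R : realType) n (q : 'cV[R]_n) : Prop :=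
  (0 <=v q) /\ \sum_j q j 0 = 1.

Definition conv_hull (R : realType) n (s : seq 'cV[R]_n) : set 'cV[R]_n :=
  [set q | exists a : 'I_(size s) -> R,
     [/\ forall i, 0 <= a i, \sum_i a i = 1 & q = \sum_i a i *: s`_i]].

(* The supremum is over a compact set, so that it is a maximum for real-valued
   [theta]; values in [\bar R] are allowed because the value functions below
   are extended-real-valued. *)
Definition risk (R : realType) n (Q : set 'cV[R]_n) (theta : 'I_n -> \bar R) :
    \bar R :=
  ereal_sup [set (\sum_j (q j 0)%:E * theta j)%E | q in Q].

(* The problem data.  Only the following indices are meaningful: stages
   1, ..., horizon for the data attached to a noise, 0, ..., horizon for
   [xdim] and [xmax].  The i-th realization of the data of stage t is obtained
   at the i-th point of the support of the t-th noise.  [riskgen t] lists the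
   probability vectors whose convex hull defines the risk measure. *)
Record mslp (R : realType) := Mslp {
  horizon : nat;
  xdim : nat -> nat;
  ydim : nat -> nat;
  cdim : nat -> nat;
  nscen : nat -> nat;
  matA : forall t, 'I_(nscen t) -> 'M[R]_(cdim t, xdim t);
  matB : forall t, 'I_(nscen t) -> 'M[R]_(cdim t, xdim t.-1);
  matT : forall t, 'I_(nscen t) -> 'M[R]_(cdim t, ydim t);
  cost : forall t, 'I_(nscen t) -> 'cV[R]_(ydim t);
  rhs : forall t, 'I_(nscen t) -> 'cV[R]_(cdim t);
  xmax : forall t, 'cV[R]_(xdim t);
  ymax : forall t, 'cV[R]_(ydim t);
  xinit : 'cV[R]_(xdim 0);
  riskgen : forall t, seq 'cV[R]_(nscen t)
}.

Arguments matA {R} _ {t}.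
Arguments matB {R} _ {t}.
Arguments matT {R} _ {t}.
Arguments cost {R} _ {t}.
Arguments rhs {R} _ {t}.

Definition stage (R : realType) (M : mslp R) : set nat :=
  [set t | (1 <= t <= horizon M)%N].

Definition riskset (R : realType) (M : mslp R) t : set 'cV[R]_(nscen M t) :=
  conv_hull (riskgen M t).

Arguments riskset {R} M t.

Record mslp_wf (R : realType) (M : mslp R) : Prop := MslpWf {
  horizon_ge1 : (1 <= horizon M)%N;
  riskgen_neq0 : forall t, stage M t -> riskgen M t != [::];
  riskgen_prob : forall t, stage M t ->
    forall q, q \in riskgen M t -> prob_vector q;
  xmax_ge0 : forall t, (t <= horizon M)%N -> 0 <=v xmax M t;
  ymax_ge0 : forall t, stage M t -> 0 <=v ymax M t;
  xinit_ge0 : 0 <=v xinit M;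
  xinit_le : xinit M <=v xmax M 0
}.

(* [w t s] is the index, in the support of the t-th noise, of the value taken
   at the outcome [s].  Taking [E t = setT] outside a subset of the stages
   gives the product rule for every subfamily. *)
Record noise_wf (R : realType) (M : mslp R) (d : measure_display)
    (Omega : measurableType d) (P : probability Omega R)
    (w : forall t, Omega -> 'I_(nscen M t)) : Prop := NoiseWf {
  noise_measurable : forall t j, stage M t ->
    measurable (w t @^-1` [set j]);
  noise_support : forall t j, stage M t -> (0 < P (w t @^-1` [set j]))%E;
  noise_indep : forall E : forall t, set 'I_(nscen M t),
    P (\bigcap_(t in stage M) (w t @^-1` E t)) =
    (\prod_(1 <= t < (horizon M).+1) P (w t @^-1` E t))%E
}.

Definition history_events (R : realType) (M : mslp R) (Omega : Type)
    (w : forall t, Omega -> 'I_(nscen M t)) (t : nat) : set (set Omega) :=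
  [set E | exists (k : nat) (A : set 'I_(nscen M k)),
     (1 <= k <= t)%N /\ E = w k @^-1` A].

(* The type [g_sigma_algebraType G] is the outcome space equipped with the
   sigma-algebra generated by [G], here the one generated by the first t
   noises. *)
Definition adapted (R : realType) (M : mslp R) (d : measure_display)
    (Omega : measurableType d) (w : forall t, Omega -> 'I_(nscen M t))
    (t n : nat) (f : Omega -> 'cV[R]_n) : Prop :=
  forall i, measurable_fun [set: g_sigma_algebraType (history_events w t)]
              (fun s => f s i 0).

Definition feasible (R : realType) (M : mslp R) (d : measure_display)
    (Omega : measurableType d) (w : forall t, Omega -> 'I_(nscen M t))
    (x : forall t, Omega -> 'cV[R]_(xdim M t))
    (y : forall t, Omega -> 'cV[R]_(ydim M t)) : Prop :=
  (forall s, x 0 s = xinit M) /\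
  forall t, stage M t ->
    [/\ adapted w t (x t),
        adapted w t (y t)
      & forall s,
        [/\ matA M (w t s) *m x t s + matB M (w t s) *m x t.-1 s
              + matT M (w t s) *m y t s = rhs M (w t s),
            0 <=v x t s, x t s <=v xmax M t,
            0 <=v y t s & y t s <=v ymax M t]].

(* Conditional risk measure: the first t-1 noises are frozen at their values
   at [s], and the risk measure of stage t is applied to the dependence on the
   t-th noise.  The random variable [Z] is meant to depend on the first t
   noises only, so that it is constant on the set from which [xget] chooses an
   outcome; the default value [s] is irrelevant, as this set is nonempty by
   independence. *)
Definition cond_risk (R : realType) (M : mslp R) (d : measure_display)
    (Omega : measurableType d) (w : forall t, Omega -> 'I_(nscen M t))
    (t : nat) (Z : Omega -> \bar R) (s : Omega) : \bar R :=
  risk (riskset M t) (fun j =>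
    Z (xget s [set s' | w t s' = j /\
                        forall k, (1 <= k < t)%N -> w k s' = w k s])).

(* Nested risk of the costs of the k consecutive stages t, ..., t + k - 1. *)
Fixpoint nested_risk (R : realType) (M : mslp R) (d : measure_display)
    (Omega : measurableType d) (w : forall t, Omega -> 'I_(nscen M t))
    (y : forall t, Omega -> 'cV[R]_(ydim M t)) (k t : nat) {struct k} :
    Omega -> \bar R :=
  if k is k'.+1 then
    cond_risk w t (fun s =>
      (dot (cost M (w t s)) (y t s))%:E + nested_risk w y k' t.+1 s)%E
  else fun=> 0%E.

(* The nested risk from stage 1 is a constant random variable. *)
Definition objective (R : realType) (M : mslp R) (d : measure_display)
    (Omega : measurableType d) (w : forall t, Omega -> 'I_(nscen M t))
    (y : forall t, Omega -> 'cV[R]_(ydim M t)) : \bar R :=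
  nested_risk w y (horizon M) 1 point.

Definition optimal_solution (R : realType) (M : mslp R) (d : measure_display)
    (Omega : measurableType d) (w : forall t, Omega -> 'I_(nscen M t))
    (x : forall t, Omega -> 'cV[R]_(xdim M t))
    (y : forall t, Omega -> 'cV[R]_(ydim M t)) : Prop :=
  feasible w x y /\
  forall x' y', feasible w x' y' -> (objective w y <= objective w y')%E.

Definition optimal_value (R : realType) (M : mslp R) (d : measure_display)
    (Omega : measurableType d) (w : forall t, Omega -> 'I_(nscen M t)) :
    \bar R :=
  ereal_inf [set v | exists x y, feasible w x y /\ v = objective w y].

(* Primal value function of stage t when k stages remain, including stage t.
   Note that [matB M j] at stage t has [xdim M t.-1] columns. *)
Fixpoint primal_rec (R : realType) (M : mslp R) (k t : nat) {struct k} :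
    'cV[R]_(xdim M t.-1) -> \bar R :=
  if k is k'.+1 then fun x =>
    ereal_inf [set v |
      exists (xs : 'I_(nscen M t) -> 'cV[R]_(xdim M t))
             (ys : 'I_(nscen M t) -> 'cV[R]_(ydim M t)),
      (forall j,
        [/\ matA M j *m xs j + matB M j *m x + matT M j *m ys j = rhs M j,
            0 <=v xs j /\ xs j <=v xmax M t,
            0 <=v ys j /\ ys j <=v ymax M t
          & (@primal_rec R M k' t.+1 (xs j) < +oo)%E]) /\
      v = risk (riskset M t) (fun j =>
            (dot (cost M j) (ys j))%:E + @primal_rec R M k' t.+1 (xs j))%E]
  else fun=> 0%E.

Arguments primal_rec {R} M k t x.

Definition primal_value (R : realType) (M : mslp R) (t : nat)
    (x : 'cV[R]_(xdim M t.-1)) : \bar R :=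
  primal_rec M ((horizon M).+1 - t) t x.

Arguments primal_value {R} M t x.

(* Dual value function of stage t when k stages follow stage t. *)
Fixpoint dual_rec (R : realType) (M : mslp R) (k t : nat) {struct k} :
    'cV[R]_(xdim M t) -> R -> \bar R :=
  if k is k'.+1 then fun p gamma =>
    ereal_sup [set v |
      exists (zeta : 'cV[R]_(xdim M t)) (gam : 'cV[R]_(nscen M t.+1))
             (lam : 'I_(nscen M t.+1) -> 'cV[R]_(cdim M t.+1))
             (ps : 'I_(nscen M t.+1) -> 'cV[R]_(xdim M t.+1))
             (xi : 'I_(nscen M t.+1) -> 'cV[R]_(ydim M t.+1)),
      [/\ [set gamma *: q | q in riskset M t.+1] gam,
          p <=v zeta + \sum_j (matB M j)^T *m lam j,
          forall j,
            [/\ ps j + (matA M j)^T *m lam j = 0,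
                0 <=v gam j 0 *: cost M j + (matT M j)^T *m lam j + xi j
              & 0 <=v xi j],
          0 <=v zeta
        & v = ((- dot (xmax M t) zeta)%:E +
               \sum_j ((- dot (rhs M j) (lam j)
                        - dot (ymax M t.+1) (xi j))%:E +
                       @dual_rec R M k' t.+1 (ps j) (gam j 0)%R))%E]]
  else fun p _ => (- dot (xmax M t) (pospart p))%:E.

Arguments dual_rec {R} M k t p gamma.

Definition dual_value (R : realType) (M : mslp R) (t : nat)
    (p : 'cV[R]_(xdim M t)) (gamma : R) : \bar R :=
  dual_rec M (horizon M - t) t p gamma.

Arguments dual_value {R} M t p gamma.

Definition conjugate (R : realType) n (f : 'cV[R]_n -> \bar R)
    (psi : 'cV[R]_n) : \bar R :=
  ereal_sup [set ((dot psi x)%:E - f x)%E | x in setT].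

(* Rockafellar's definition: the function whose epigraph is the recession cone
   of the epigraph of [g]. *)
Definition recession (R : realType) n (g : 'cV[R]_n -> \bar R)
    (psi : 'cV[R]_n) : \bar R :=
  ereal_inf [set mu%:E | mu in [set mu : R |
    forall (z : 'cV[R]_n) (r a : R), 0 <= a -> (g z <= r%:E)%E ->
      (g (z + a *: psi)%R <= (r + a * mu)%:E)%E]].

(* Perspectives take the value +oo for negative scalings. *)
Definition coperspective (R : realType) n (f : 'cV[R]_n -> \bar R)
    (psi : 'cV[R]_n) (gamma : R) : \bar R :=
  if 0 < gamma then (gamma%:E * conjugate f (gamma^-1 *: psi)%R)%E
  else if gamma == 0 then recession (conjugate f) psi
  else +oo%E.

Definition lipschitz_reg (R : realType) n (xbar : 'cV[R]_n)
    (W : 'cV[R]_n -> R -> \bar R) (p : 'cV[R]_n) (gamma : R) : \bar R :=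
  ereal_inf [set v | exists zeta psi : 'cV[R]_n,
    [/\ p <=v zeta + psi, 0 <=v zeta
      & v = ((dot xbar zeta)%:E + W psi gamma)%E]].

(* In [\bar R], (+oo) + (-oo) = -oo, so that this says that the hypograph is
   convex. *)
Definition concave_on_nneg (R : realType) n (D : 'cV[R]_n -> R -> \bar R) :
    Prop :=
  forall (p1 p2 : 'cV[R]_n) (g1 g2 a : R),
    0 <= g1 -> 0 <= g2 -> 0 <= a <= 1 ->
    (a%:E * D p1 g1 + (1 - a)%:E * D p2 g2 <=
       D (a *: p1 + (1 - a) *: p2)%R (a * g1 + (1 - a) * g2)%R)%E.

Definition pos_homogeneous_on_nneg (R : realType) n
    (D : 'cV[R]_n -> R -> \bar R) : Prop :=
  forall (p : 'cV[R]_n) (g a : R), 0 <= g -> 0 < a ->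
    D (a *: p) (a * g) = (a%:E * D p g)%E.

(* Main.v *)
Require Import Defs.
From HB Require Import structures.
From mathcomp Require Import all_boot all_order all_algebra.
From mathcomp Require Import all_classical all_reals all_analysis.
From mathcomp Require Import ring lra.

Set Implicit Arguments.
Unset Strict Implicit.
Unset Printing Implicit Defensive.

Import Order.TTheory GRing.Theory Num.Theory.
Import numFieldNormedType.Exports.

Local Open Scope classical_set_scope.
Local Open Scope ring_scope.

(** The whole statement rests on one formula: for gamma >= 0, D_t (p, gamma) is
    the minimum of gamma V_(t+1)(x) - p^T x over the states x of the box
    [0, xmax_t] at which V_(t+1) is finite.  This is proved by induction from
    the last stage backwards ([dual_pair], [dual_pair_step]).

    In the problem that defines D_t, the best zeta and xi for given gam and lam
    are positive parts, and xmax^T max(u, 0) is the maximum of u^T x over the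
    box.  Together with the formula at the next stage, this turns the objective
    into the minimum, over bounded states and controls, of a Lagrangian that is
    bilinear in these decisions and in (gam, lam), where gam / gamma ranges over
    the risk set and lam is free.  Exchanging supremum and minimum gives the
    recursion of the primal value function: the supremum over lam enforces the
    constraints and the one over gam gives the risk.  The exchange is a minimax
    theorem that needs compactness on the primal side: the costs of the remaining
    stages are bounded, so V_(t+1) is bounded on its domain, and the part of its
    epigraph that matters is compact.

    Compactness enters in an algebraic form, [minimax_set]: if each point of a
    set is made positive by a member of a convex cone of affine forms, then a
    single member is positive on the whole set.  This property is proved for a
    segment by Helly's theorem on the line, and passes to affine images,
    products and convex constraints, which is all that the recursion uses.  It
    also gives attained minima ([minimax_set_min]).

    For the coperspective, the difficulty is that it involves V_(t+1) on the
    whole space, and not only on the box.  But the state enters the recursion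
    through the linear terms B_j x alone, so a dual feasible point provides an
    affine minorant of gamma V_(t+1) on the whole space ([dual_step_weak]).
    The minorants bound the infimum of the regularization from above by -D_t,
    and the minimizer over the box bounds it from below
    ([dp_lipschitz_reg]).  Concavity and homogeneity are read off the minimum.

    Finally the optimal value of the multistage problem is V_1(x_0), by dynamic
    programming ([optimal_value_primal]), and V_1 restricted to the box equals
    its biconjugate at x_0 ([dp_biconjugate]); the conjugate of that
    restriction is - D_0 (., 1). *)

(** * Affine maps and forms *)

Section Affine.
Context {R : realType}.
Implicit Types E F G : lmodType R.

Definition affine_map E F (f : E -> F) : Prop :=
  forall (s : R) x y, f (s *: x + (1 - s) *: y) = s *: f x + (1 - s) *: f y.

Definition affine_form E (f : E -> R) : Prop := @affine_map E R^o f.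

Lemma affine_map_comp E F G (g : F -> G) (f : E -> F) :
  affine_map g -> affine_map f -> affine_map (g \o f).
Proof. by move=> ga fa s x y /=; rewrite fa ga. Qed.

Lemma affine_map_cst E F (c : F) : affine_map (fun _ : E => c).
Proof. by move=> s x y; rewrite -scalerDl addrC subrK scale1r. Qed.

Lemma affine_map_id E : affine_map (@id E).
Proof. by []. Qed.

Lemma affine_map_fst E F G (f : E -> F * G) :
  affine_map f -> affine_map (fun x => (f x).1).
Proof. by move=> fa s x y; rewrite fa. Qed.

Lemma affine_map_snd E F G (f : E -> F * G) :
  affine_map f -> affine_map (fun x => (f x).2).
Proof. by move=> fa s x y; rewrite fa. Qed.

Lemma affine_map_app E F (I : Type) (f : E -> (I -> F)) i :
  affine_map f -> affine_map (fun x => f x i).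
Proof. by move=> fa s x y; rewrite fa. Qed.

Lemma affine_map_pair E F G (f : E -> F) (g : E -> G) :
  affine_map f -> affine_map g -> affine_map (fun x => (f x, g x)).
Proof. by move=> fa ga s x y; rewrite fa ga. Qed.

Lemma affine_form_cst E (c : R) : affine_form (fun _ : E => c).
Proof. exact: (@affine_map_cst _ R^o). Qed.

Lemma affine_formD E (f g : E -> R) :
  affine_form f -> affine_form g -> affine_form (fun x => f x + g x).
Proof.
move=> fa ga s x y; rewrite fa ga /GRing.scale /=; ring.
Qed.

Lemma affine_formZ E (c : R) (f : E -> R) :
  affine_form f -> affine_form (fun x => c * f x).
Proof. by move=> fa s x y; rewrite fa /GRing.scale /=; ring. Qed.

Lemma affine_formN E (f : E -> R) :
  affine_form f -> affine_form (fun x => - f x).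
Proof. by move=> fa s x y; rewrite fa /GRing.scale /=; ring. Qed.

Lemma affine_formB E (f g : E -> R) :
  affine_form f -> affine_form g -> affine_form (fun x => f x - g x).
Proof. by move=> fa ga; exact: affine_formD fa (affine_formN ga). Qed.

Lemma affine_form_sum E (I : Type) (r : seq I) (f : I -> E -> R) :
  (forall i, affine_form (f i)) -> affine_form (fun x => \sum_(i <- r) f i x).
Proof.
move=> fa s x y; elim: r => [|i r IH].
  by rewrite !big_nil /GRing.scale /=; ring.
by rewrite !big_cons IH fa /GRing.scale /=; ring.
Qed.

Lemma affine_form_comp E F (g : F -> R) (f : E -> F) :
  affine_form g -> affine_map f -> affine_form (fun x => g (f x)).
Proof. exact: (@affine_map_comp _ _ R^o). Qed.

(** The segments from (x', y) to (x, 0) and from (x, y) to (x', 0) have the same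
    midpoint. *)
Lemma affine_form_pairE E F (f : E * F -> R) x y x' : affine_form f ->
  f (x', y) = f (x, y) + (f (x', 0) - f (x, 0)).
Proof.
move=> fa.
have key u v : 2%:R * f (2^-1 *: u + (1 - 2^-1) *: v) = f u + f v.
  by rewrite fa /GRing.scale /=; field.
have := key (x', y) (x, 0); have := key (x, y) (x', 0).
rewrite (_ : 2^-1 *: (x', y) + _ = 2^-1 *: (x, y) + (1 - 2^-1) *: (x', 0)).
  lra.
have -> : 1 - 2^-1 = 2^-1 :> R by field.
by congr pair => /=; rewrite addrC.
Qed.

(** * Compactness tested on cones of affine forms *)

Record form_cone E (C : set (E -> R)) : Prop := FormCone {
  form_cone_affine : forall f, C f -> affine_form f;
  form_cone0 : C (fun _ => 0);
  form_coneD : forall f g, C f -> C g -> C (fun x => f x + g x);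
  form_coneZ : forall a f, 0 <= a -> C f -> C (fun x => a * f x)
}.

(** Compact convex sets of finite dimension have this property, by Sion's
    minimax theorem.  It is used as the notion of compactness: affine forms are
    the only functions that have to be controlled, so that products and sections
    can be handled without a topology. *)
Definition minimax_set E (X : set E) : Prop :=
  forall C : set (E -> R), form_cone C ->
    (forall x, X x -> exists2 f, C f & 0 < f x) ->
    exists f (e : R), [/\ C f, 0 < e & forall x, X x -> e <= f x].

Lemma minimax_set1 E (x : E) : minimax_set [set x].
Proof.
move=> C _ /(_ x erefl)[f Cf fx]; exists f, (f x).
by split => // y ->.
Qed.

Lemma minimax_set_image E F (X : set E) (h : E -> F) :
  affine_map h -> minimax_set X -> minimax_set (h @` X).
Proof.
move=> ha Xm C Cc CX.
have [|x Xx|g [e [[f Cf <-] e0 fX]]] := Xm [set f \o h | f in C].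
- split => [_ [f Cf <-]||_ _ [f Cf <-] [g Cg <-]|a _ a0 [f Cf <-]].
  + exact: affine_map_comp (form_cone_affine Cc Cf) ha.
  + by exists (fun=> 0) => //; exact: form_cone0 Cc.
  + by exists (fun x => f x + g x) => //; exact: form_coneD Cc _ _ Cf Cg.
  + by exists (fun x => a * f x) => //; exact: form_coneZ Cc _ _ a0 Cf.
- by have [f Cf fx] := CX _ (imageP h Xx); exists (f \o h) => //; exists f.
- by exists f, e; split => // _ [x Xx <-]; exact: fX.
Qed.

(** The constraints join the family to be combined: a combination that is
    positive on all of [X] is positive through its [C]-part where the
    constraints hold. *)
Lemma minimax_set_constr E (X : set E) (K : set (E -> R)) :
  form_cone K -> minimax_set X ->
  minimax_set [set x | X x /\ forall g, K g -> g x <= 0].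
Proof.
move=> Kc Xm C Cc CX.
have [|x Xx|_ [e [[f Cf [g Kg <-]] e0 fX]]] :=
  Xm [set h | exists2 f, C f & exists2 g, K g & (fun x => f x + g x) = h].
- split => [_ [f Cf [g Kg <-]]||_ _ [f Cf [g Kg <-]] [f' Cf' [g' Kg' <-]]
           |a _ a0 [f Cf [g Kg <-]]].
  + exact: affine_formD (form_cone_affine Cc Cf) (form_cone_affine Kc Kg).
  + exists (fun=> 0); first exact: form_cone0 Cc.
    exists (fun=> 0); first exact: form_cone0 Kc.
    by apply/funext => x; rewrite addr0.
  + exists (fun x => f x + f' x); first exact: form_coneD Cc _ _ Cf Cf'.
    exists (fun x => g x + g' x); first exact: form_coneD Kc _ _ Kg Kg'.
    by apply/funext => x; rewrite addrACA.
  + exists (fun x => a * f x); first exact: form_coneZ Cc _ _ a0 Cf.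
    exists (fun x => a * g x); first exact: form_coneZ Kc _ _ a0 Kg.
    by apply/funext => x; rewrite mulrDr.
- have [xK|/existsNP[g /not_implyP[Kg /negP gx]]] :=
    pselect (forall g, K g -> g x <= 0).
    have [f Cf fx] := CX x (conj Xx xK).
    exists f => //; exists f => //; exists (fun=> 0).
      exact: form_cone0 Kc.
    by apply/funext => y; rewrite addr0.
  exists g; last by rewrite ltNge.
  exists (fun=> 0); first exact: form_cone0 Cc.
  by exists g => //; apply/funext => y; rewrite add0r.
- exists f, e; split => // x [Xx xK].
  by apply: le_trans (fX _ Xx) _; rewrite gerDl; exact: xK.
Qed.

Lemma minimax_set_prod E F (X : set E) (Y : set F) :
  minimax_set X -> minimax_set Y -> minimax_set (X `*` Y).
Proof.
move=> Xm Ym C Cc CXY.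
have [|x Xx|g [e [[ga [f Cf fg]] e0 gX]]] :=
  Xm [set g | affine_form g /\
     exists2 f, C f & forall x y, Y y -> g x <= f (x, y)].
- split => [g []//|||].
  + split; first exact: affine_form_cst.
    by exists (fun=> 0); first exact: form_cone0 Cc.
  + move=> g g' [ga [f Cf fg]] [ga' [f' Cf' fg']].
    split; first exact: affine_formD.
    exists (fun z => f z + f' z); first exact: form_coneD Cc _ _ Cf Cf'.
    by move=> x y Yy; apply: lerD; [exact: fg|exact: fg'].
  + move=> a g a0 [ga [f Cf fg]]; split; first exact: affine_formZ.
    exists (fun z => a * f z); first exact: form_coneZ Cc _ _ a0 Cf.
    by move=> x y Yy; apply: ler_wpM2l => //; exact: fg.
- (* With x frozen, Y provides one form bounded below by e on {x} * Y; by the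
     splitting of affine forms this bound propagates affinely in x. *)
  have pa : affine_map (fun y : F => (x, y)).
    by apply: affine_map_pair; [exact: affine_map_cst|exact: affine_map_id].
  have [|y Yy|_ [e [[f Cf <-] e0 fY]]] :=
      Ym [set (fun y => f (x, y)) | f in C].
  + split => [_ [f Cf <-]||_ _ [f Cf <-] [g Cg <-]|a _ a0 [f Cf <-]].
    * exact: affine_form_comp (form_cone_affine Cc Cf) pa.
    * by exists (fun=> 0) => //; exact: form_cone0 Cc.
    * by exists (fun z => f z + g z) => //; exact: form_coneD Cc _ _ Cf Cg.
    * by exists (fun z => a * f z) => //; exact: form_coneZ Cc _ _ a0 Cf.
  + have [f Cf fxy] := CXY (x, y) (conj Xx Yy).
    by exists (fun y => f (x, y)) => //; exists f.
  + have fa := form_cone_affine Cc Cf.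
    exists (fun x' => e + (f (x', 0) - f (x, 0))); last by rewrite subrr addr0.
    split.
      apply: affine_formD; first exact: affine_form_cst.
      apply: affine_formB; last exact: affine_form_cst.
      apply: (affine_form_comp fa).
      by apply: affine_map_pair; [exact: affine_map_id|exact: affine_map_cst].
    exists f => // x' y Yy.
    by rewrite (affine_form_pairE x y x' fa) lerD2r; exact: fY.
- exists f, e; split => // -[x y] [/= Xx Yy].
  exact: le_trans (gX _ Xx) (fg _ _ Yy).
Qed.

Lemma minimax_set_funord E n (X : 'I_n -> set E) :
  (forall i, minimax_set (X i)) ->
  minimax_set [set z : 'I_n -> E | forall i, X i (z i)].
Proof.
elim: n X => [|n IH] X Xm.
  rewrite (_ : [set _ | _] = [set (fun=> 0)]); first exact: minimax_set1.
  apply/seteqP; split => z /=; last by move=> _ [].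
  by move=> _; apply/funext => -[].
pose h (p : E * ('I_n -> E)) (i : 'I_n.+1) : E :=
  if unlift ord0 i is Some j then p.2 j else p.1.
have ha : affine_map h.
  move=> s x y; apply/funext => i.
  rewrite [RHS](_ : _ = s *: h x i + (1 - s) *: h y i) // /h.
  by case: unlift.
rewrite (_ : [set _ | _] = h @` (X ord0 `*`
    [set z : 'I_n -> E | forall i, X (lift ord0 i) (z i)])).
  apply: minimax_set_image => //; apply: minimax_set_prod => //.
  exact: (IH (fun i => X (lift ord0 i))).
apply/seteqP; split => [z zX|_ [[x z] [/= Xx Xz] <-] i].
  exists (z ord0, fun i => z (lift ord0 i)); first by split => //= i.
  by apply/funext => i; rewrite /h /=; case: unliftP => [j|] ->.
by rewrite /h /=; case: unliftP => [j|] ->.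
Qed.

(** Helly's theorem on the line: a form that is not positive on all of [a, b]
    cuts off an end of the segment, and the cuts from the left and from the
    right leave a common point, since an increasing and a decreasing form whose
    maximum is positive have a positive constant combination. *)
Lemma minimax_set_itv (a b : R) :
  minimax_set [set x : R^o | a <= (x : R) <= b].
Proof.
move=> C Cc CX; apply: contrapT => noF.
have [ab|ba] := leP a b; last first.
  apply: noF; exists (fun=> 0), 1; split => //; first exact: form_cone0 Cc.
  by move=> x /= /andP[ax xb]; lra.
have line f : C f -> exists c m, forall x : R, f x = c + x * m.
  move=> Cf; exists (f 0), (f 1 - f 0) => x.
  have := form_cone_affine Cc Cf x 1 0.
  rewrite [_ *: 1 + _](_ : _ = x); last by rewrite /GRing.scale /=; ring.
  by move=> ->; rewrite /GRing.scale /=; ring.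
have pos_ab f : C f -> 0 < f a -> 0 < f b -> False.
  move=> Cf fa fb; apply: noF.
  exists f, (Num.min (f a) (f b)); split => //; first by rewrite lt_min fa fb.
  move=> x /= /andP[ax xb]; have [c [m lf]] := line f Cf.
  rewrite ge_min !lf !lerD2l.
  have [s0|s0] := leP 0 m; first by rewrite ler_wpM2r.
  by rewrite [X in _ || X]ler_wnM2r ?orbT // ltW.
pose L := [set l : R | a <= l <= b /\
             (l = a \/ exists g, [/\ C g, 0 < g a & 0 < g l])].
have Lsup : has_sup L.
  by split; [exists a; split; [rewrite lexx|left] | exists b => l [/andP[]]].
have La : L a by split; [rewrite lexx|left].
have asL : a <= sup L by apply: ub_le_sup; [exact: Lsup.2|].
have sLb : sup L <= b by apply: ge_sup; [exact: Lsup.1|move=> l [/andP[]]].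
have [|f Cf fs] := CX (sup L); first by rewrite /= asL sLb.
have [c [m lf]] := line f Cf.
rewrite lf in fs.
have zero : m != 0 -> c / - m * m = - c by move=> m0; field.
have [fa|fa] := ltP 0 (f a).
  have fb : f b <= 0 by rewrite leNgt; apply/negP => fb; exact: (pos_ab f).
  rewrite lf in fb.
  have slope : m < 0 by nra.
  have [l [sl lb fl]] : exists l, [/\ sup L < l, l <= b & 0 < f l].
    (* halfway between sup L and the zero of f *)
    have := zero (ltr0_neq0 slope); set z := c / - m => h1.
    exists ((sup L + z) / 2); split; [nra|nra|].
    by rewrite lf; nra.
  have := ub_le_sup Lsup.2 (_ : L l).
  rewrite leNgt sl => /(_ _)/negP; apply => //.
  by split; [rewrite lb andbT; lra|right; exists f].
have fa' := fa; rewrite lf in fa'.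
have slope : 0 < m.
  rewrite ltNge; apply/negP => s0; nra.
have [l [lsL fl]] : exists l, l < sup L /\ 0 < f l.
  have := zero (lt0r_neq0 slope); set z := c / - m => h1.
  exists ((sup L + z) / 2); split; [nra|].
  by rewrite lf; nra.
have [l' Ll' ll'] := sup_gt Lsup.1 lsL.
case: Ll' => /andP[al' l'b] [l'a|[g [Cg ga gl']]].
  by move: fl; rewrite lf -l'a in ll' fa' * => fl; nra.
have [c' [m' lg]] := line g Cg.
have gb : g b <= 0 by rewrite leNgt; apply/negP => gb; exact: (pos_ab g).
have sg : m' < 0 by rewrite !lg in ga gb gl'; nra.
(* The weights cancel the slopes, so that the combination is constant. *)
pose h x := (- m') * f x + m * g x.
have Ch : C h.
  apply: (form_coneD Cc); apply: (form_coneZ Cc) => //; last exact: ltW.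
  by rewrite oppr_ge0 ltW.
have hc x : h x = h l' by rewrite /h !lf !lg; ring.
have hl' : 0 < h l'.
  rewrite /h; apply: addr_gt0; apply: mulr_gt0 => //; first by rewrite oppr_gt0.
  by move: fl; rewrite !lf => fl; nra.
by apply: (pos_ab h); rewrite ?hc.
Qed.

(** Weierstrass for affine forms: otherwise the forms a * f + b that are
    nonpositive at some point of [X] make a cone with a member positive at each
    point of [X]. *)
Lemma minimax_set_min E (X : set E) (f : E -> R) :
  minimax_set X -> affine_form f -> X !=set0 ->
  exists2 x, X x & forall y, X y -> f x <= f y.
Proof.
move=> Xm fa [x0 Xx0]; apply: contrapT => nomin.
pose C := [set g | exists (a b : R),
  [/\ 0 <= a, exists2 y, X y & a * f y + b <= 0 & g = (fun x => a * f x + b)]].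
have [|x Xx|g [e [[a [b [a0 [y Xy yab] ->]]] e0 gX]]] := Xm C.
- split.
  + move=> _ [a [b [a0 _ ->]]].
    exact: affine_formD (affine_formZ a fa) (affine_form_cst b).
  + exists 0, 0; split => //; first by exists x0 => //; rewrite mul0r addr0.
    by apply/funext => x; rewrite mul0r addr0.
  + move=> _ _ [a [b [a0 [y Xy yab] ->]]] [a' [b' [a0' [y' Xy' yab'] ->]]].
    exists (a + a'), (b + b'); split; first exact: addr_ge0.
      have [yy'|y'y] := leP (f y) (f y').
        by exists y => //; nra.
      by exists y' => //; nra.
    by apply/funext => x; ring.
  + move=> c _ c0 [a [b [a0 [y Xy yab] ->]]].
    exists (c * a), (c * b); split; first exact: mulr_ge0.
      by exists y => //; nra.
    by apply/funext => x; ring.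
- have [y Xy yx] : exists2 y, X y & f y < f x.
    apply: contrapT => noy; apply: nomin; exists x => // y Xy.
    by rewrite leNgt; apply/negP => yx; apply: noy; exists y.
  exists (fun z => 1 * f z + - f y); last by rewrite mul1r subr_gt0.
  by exists 1, (- f y); split => //; exists y => //; rewrite mul1r subrr.
- by have := gX _ Xy; lra.
Qed.

End Affine.
(** * Vectors and boxes *)

Section Vectors.
Context {R : realType}.

Lemma dotE n (u v : 'cV[R]_n) : dot u v = \sum_i u i 0 * v i 0.
Proof. by rewrite /dot mxE; apply: eq_bigr => i _; rewrite mxE. Qed.

Lemma dotC n (u v : 'cV[R]_n) : dot u v = dot v u.
Proof. by rewrite !dotE; apply: eq_bigr => i _; rewrite mulrC. Qed.

Lemma dotDr n (u v w : 'cV[R]_n) : dot u (v + w) = dot u v + dot u w.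
Proof. by rewrite /dot mulmxDr mxE. Qed.

Lemma dotZr n a (u v : 'cV[R]_n) : dot u (a *: v) = a * dot u v.
Proof. by rewrite /dot -scalemxAr mxE. Qed.

Lemma dotDl n (u v w : 'cV[R]_n) : dot (u + v) w = dot u w + dot v w.
Proof. by rewrite dotC dotDr !(dotC w). Qed.

Lemma dotZl n a (u v : 'cV[R]_n) : dot (a *: u) v = a * dot u v.
Proof. by rewrite dotC dotZr dotC. Qed.

Lemma dotNr n (u v : 'cV[R]_n) : dot u (- v) = - dot u v.
Proof. by rewrite -scaleN1r dotZr mulN1r. Qed.

Lemma dotNl n (u v : 'cV[R]_n) : dot (- u) v = - dot u v.
Proof. by rewrite dotC dotNr dotC. Qed.

Lemma dotBr n (u v w : 'cV[R]_n) : dot u (v - w) = dot u v - dot u w.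
Proof. by rewrite dotDr dotNr. Qed.

Lemma dot0l n (u : 'cV[R]_n) : dot 0 u = 0.
Proof. by rewrite -(scale0r 0) dotZl mul0r. Qed.

Lemma dot0r n (u : 'cV[R]_n) : dot u 0 = 0.
Proof. by rewrite dotC dot0l. Qed.

Lemma dot_suml n (I : Type) (r : seq I) (F : I -> 'cV[R]_n) v :
  dot (\sum_(i <- r) F i) v = \sum_(i <- r) dot (F i) v.
Proof.
by elim/big_rec2: _ => [|i x y _ <-]; rewrite ?dot0l ?dotDl.
Qed.

Lemma dot_trmx m n (A : 'M[R]_(m, n)) l x : dot (A^T *m l) x = dot l (A *m x).
Proof. by rewrite /dot trmx_mul trmxK mulmxA. Qed.

Lemma dot_self_eq0 n (u : 'cV[R]_n) : dot u u <= 0 -> u = 0.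
Proof.
rewrite dotE => u0; apply/colP => i; rewrite mxE.
have sq j : 0 <= u j 0 * u j 0 by rewrite -expr2 sqr_ge0.
have : \sum_j u j 0 * u j 0 == 0.
  by rewrite eq_le u0 /=; apply: sumr_ge0.
rewrite psumr_eq0 // => /allP/(_ i).
by rewrite mem_index_enum -expr2 sqrf_eq0 => /(_ erefl)/eqP.
Qed.

Lemma dot_le n (u v w : 'cV[R]_n) : 0 <=v u -> v <=v w -> dot u v <= dot u w.
Proof.
move=> u0 vw; rewrite !dotE; apply: ler_sum => i _.
by apply: ler_wpM2l => //; have := u0 i; rewrite mxE.
Qed.

Lemma dot_ge0 n (u v : 'cV[R]_n) : 0 <=v u -> 0 <=v v -> 0 <= dot u v.
Proof. by move=> u0 v0; rewrite -(dot0r u); exact: dot_le. Qed.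

Lemma affine_form_dot n (E : lmodType R) (u : 'cV[R]_n) (f : E -> 'cV[R]_n) :
  affine_map f -> affine_form (fun x => dot u (f x)).
Proof. by move=> fa s x y; rewrite fa dotDr !dotZr. Qed.

Lemma affine_map_mulmx m n (E : lmodType R) (A : 'M[R]_(m, n))
    (f : E -> 'cV[R]_n) : affine_map f -> affine_map (fun x => A *m f x).
Proof. by move=> fa s x y; rewrite fa mulmxDr -!scalemxAr. Qed.

Lemma affine_mapD (E F : lmodType R) (f g : E -> F) :
  affine_map f -> affine_map g -> affine_map (fun x => f x + g x).
Proof. by move=> fa ga s x y; rewrite fa ga !scalerDr addrACA. Qed.

Definition box n (b : 'cV[R]_n) : set 'cV[R]_n :=
  [set x | 0 <=v x /\ x <=v b].

Lemma minimax_set_box n (b : 'cV[R]_n) : minimax_set (box b).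
Proof.
pose h (z : 'I_n -> R^o) : 'cV[R]_n := \col_i (z i : R).
have ha : affine_map h by move=> s x y; apply/colP => i; rewrite !mxE.
rewrite (_ : box b = h @` [set z | forall i,
    [set x : R^o | 0 <= (x : R) <= b i 0] (z i)]).
  apply: minimax_set_image ha _.
  apply: (@minimax_set_funord _ _ _
    (fun i => [set x : R^o | 0 <= (x : R) <= b i 0])) => i.
  exact: minimax_set_itv.
apply/seteqP; split => [x [x0 xb]|_ [z zb <-]].
  exists (fun i => x i 0); last by apply/colP => i; rewrite mxE.
  by move=> i /=; have := x0 i; rewrite mxE => ->; exact: xb.
by split => i; rewrite !mxE; have /andP[] := zb i.
Qed.

Lemma pospart_ge0 n (p : 'cV[R]_n) : 0 <=v pospart p.
Proof. by move=> i; rewrite !mxE le_max lexx. Qed.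

Lemma le_pospart n (p : 'cV[R]_n) : p <=v pospart p.
Proof. by move=> i; rewrite !mxE le_max lexx orbT. Qed.

Lemma dot_box_le n (b x p z : 'cV[R]_n) :
  box b x -> 0 <=v z -> p <=v z -> dot p x <= dot b z.
Proof.
move=> [x0 xb] z0 pz; apply: (@le_trans _ _ (dot z x)).
  by rewrite !(dotC _ x); exact: dot_le.
by rewrite (dotC b); exact: dot_le.
Qed.

(** The penalty of the one-sided Lipschitz regularization is the support
    function of the box; hence regularizing the conjugate of a function amounts
    to restricting this function to the box. *)
Lemma dot_box_max n (b p : 'cV[R]_n) : 0 <=v b ->
  exists2 x, box b x & dot p x = dot b (pospart p).
Proof.
move=> b0; have b0' i : 0 <= b i 0 by have := b0 i; rewrite mxE.
exists (\col_i (if 0 <= p i 0 then b i 0 else 0)).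
  by split=> i; rewrite !mxE; case: ifP.
rewrite !dotE; apply: eq_bigr => i _; rewrite !mxE.
have [p0|p0] := leP 0 (p i 0); first by rewrite mulrC.
by rewrite !mulr0.
Qed.

End Vectors.

(** * Polyhedral risk measures *)

Section Risk.
Context {R : realType} {N : nat}.
Implicit Types (Q : set 'cV[R]_N) (q gam : 'cV[R]_N).

Record ambiguity_set Q : Prop := AmbiguitySet {
  ambiguity_nonempty : Q !=set0;
  ambiguity_prob : forall q, Q q -> prob_vector q;
  ambiguity_convex : forall (s : R) q q', 0 <= s <= 1 -> Q q -> Q q' ->
    Q (s *: q + (1 - s) *: q')
}.

Lemma ambiguity_conv_hull (s : seq 'cV[R]_N) : s != [::] ->
  (forall q, q \in s -> prob_vector q) -> ambiguity_set (conv_hull s).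
Proof.
move=> s0 sP; split.
- case: s s0 {sP} => // q s _; exists q.
  exists (fun i => if i == ord0 then 1 else 0); split.
  + by move=> i; case: ifP.
  + rewrite big_ord_recl /= big1 ?addr0 //.
  + rewrite big_ord_recl /= big1 ?addr0 ?scale1r // => i _.
    by rewrite scale0r.
- move=> _ [a [a0 a1 ->]].
  have sP' (i : 'I_(size s)) : prob_vector s`_i by apply: sP; exact: mem_nth.
  split.
    move=> j; rewrite mxE summxE; apply: sumr_ge0 => i _; rewrite mxE.
    by apply: mulr_ge0 => //; have := (sP' i).1 j; rewrite mxE.
  under eq_bigr => j _ do rewrite summxE.
  rewrite exchange_big /= -[RHS]a1; apply: eq_bigr => i _.
  under eq_bigr => j _ do rewrite mxE.
  by rewrite -mulr_sumr (sP' i).2 mulr1.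
- move=> r _ _ /andP[r0 r1] [a [a0 a1 ->]] [b [b0 b1 ->]].
  exists (fun i => r * a i + (1 - r) * b i); split.
  + by move=> i; apply: addr_ge0; apply: mulr_ge0; rewrite ?subr_ge0.
  + by rewrite big_split /= -!mulr_sumr a1 b1; ring.
  + rewrite !scaler_sumr -big_split /=; apply: eq_bigr => i _.
    by rewrite [RHS]scalerDl !scalerA.
Qed.

Lemma ambiguity_scaleD Q a b gam gam' : ambiguity_set Q -> 0 <= a -> 0 <= b ->
  [set a *: q | q in Q] gam -> [set b *: q | q in Q] gam' ->
  [set (a + b) *: q | q in Q] (gam + gam').
Proof.
move=> QA a0 b0 [q Qq <-] [q' Qq' <-].
have [/eqP|ab] := eqVneq (a + b) 0.
  rewrite paddr_eq0 // => /andP[/eqP -> /eqP ->].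
  by exists q => //; rewrite addr0 !scale0r addr0.
exists ((a / (a + b)) *: q + (1 - a / (a + b)) *: q'); last first.
  rewrite scalerDr !scalerA; congr (_ *: _ + _ *: _); field => //.
apply: ambiguity_convex => //; apply/andP; split.
  by rewrite divr_ge0 // addr_ge0.
by rewrite ler_pdivrMr ?mul1r ?lerDl // lt0r ab addr_ge0.
Qed.

Lemma ambiguity_scale0 Q : ambiguity_set Q -> [set 0 *: q | q in Q] 0.
Proof. by move=> [[q Qq] _ _]; exists q => //; rewrite scale0r. Qed.

Lemma ambiguity_scaleZ Q a b gam :
  [set a *: q | q in Q] gam -> [set (b * a) *: q | q in Q] (b *: gam).
Proof. by move=> [q Qq <-]; exists q => //; rewrite scalerA. Qed.

Lemma ambiguity_scale_ge0 Q a gam : ambiguity_set Q -> 0 <= a ->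
  [set a *: q | q in Q] gam -> forall j, 0 <= gam j 0.
Proof.
move=> QA a0 [q Qq <-] j; rewrite mxE mulr_ge0 //.
by have := (ambiguity_prob QA Qq).1 j; rewrite mxE.
Qed.

Lemma sumEFinM q (r : 'I_N -> R) :
  (\sum_j (q j 0)%:E * (r j)%:E)%E = (\sum_j q j 0 * r j)%:E.
Proof. by rewrite sumEFin. Qed.

Lemma risk_le Q (r : 'I_N -> R) v :
  (forall q, Q q -> \sum_j q j 0 * r j <= v) ->
  (risk Q (fun j => (r j)%:E) <= v%:E)%E.
Proof.
move=> rv; apply: ge_ereal_sup => _ [q Qq <-].
by rewrite sumEFinM lee_fin; exact: rv.
Qed.

Lemma le_risk Q (r : 'I_N -> R) q : Q q ->
  ((\sum_j q j 0 * r j)%:E <= risk Q (fun j => (r j)%:E))%E.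
Proof.
by move=> Qq; apply: ereal_sup_ubound; exists q => //; exact: sumEFinM.
Qed.

Lemma le_risk_homo Q (t t' : 'I_N -> \bar R) : ambiguity_set Q ->
  (forall j, (t j <= t' j)%E) -> (risk Q t <= risk Q t')%E.
Proof.
move=> QA tt'; apply: ge_ereal_sup => _ [q Qq <-].
apply: (@le_trans _ _ (\sum_j (q j 0)%:E * t' j)%E); last first.
  by apply: ereal_sup_ubound; exists q.
apply: lee_sum => j _; apply: lee_wpmul2l => //.
by rewrite lee_fin; have := (ambiguity_prob QA Qq).1 j; rewrite mxE.
Qed.

Lemma prob_vector_le1 q j : prob_vector q -> q j 0 <= 1.
Proof.
move=> [q0 <-]; rewrite (bigD1 j) //= lerDl.
by apply: sumr_ge0 => i _; have := q0 i; rewrite mxE.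
Qed.

Lemma risk_fin Q (r : 'I_N -> R) : ambiguity_set Q ->
  exists v, risk Q (fun j => (r j)%:E) = v%:E.
Proof.
move=> QA; have [q Qq] := ambiguity_nonempty QA.
have lo := le_risk r Qq.
have hi : (risk Q (fun j => (r j)%:E) <= (\sum_j `|r j|)%:E)%E.
  apply: risk_le => p Qp; apply: ler_sum => j _.
  have pj := (ambiguity_prob QA Qp).1 j; rewrite mxE in pj.
  apply: le_trans (ler_norm _) _.
  by rewrite normrM ger0_norm // ler_piMl // prob_vector_le1 //;
     exact: ambiguity_prob Qp.
by case: risk lo hi => [v| |] // _ _; exists v.
Qed.

Lemma prob_vector_inhab q : prob_vector q -> inhabited 'I_N.
Proof.
move=> [_]; case: N q => [|k] q q1; last by split; exact: ord0.
by move: q1; rewrite big_ord0 => /esym/eqP; rewrite oner_eq0.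
Qed.

End Risk.
(** * The duality formula as an induction hypothesis *)

Section DualPair.
Context {R : realType} {n : nat}.
Implicit Types (b : 'cV[R]_n) (V : 'cV[R]_n -> \bar R).

Lemma minimax_set_bounded (E : lmodType R) (X : set E) (f : E -> R) :
  minimax_set X -> affine_form f -> exists K, forall x, X x -> `|f x| <= K.
Proof.
move=> Xm fa; have [X0|X0] := pselect (X !=set0); last first.
  by exists 0 => x Xx; case: X0; exists x.
have [x Xx xmin] := minimax_set_min Xm fa X0.
have [y Xy ymax] := minimax_set_min Xm (affine_formN fa) X0.
exists (`|f x| + `|f y|) => z Xz.
have := xmin z Xz; have := ymax z Xz.
have := ler_norm (f y); have := ler_norm (- f x); rewrite normrN.
have := normr_ge0 (f x); have := normr_ge0 (f y).
by rewrite ler_norml => ? ? ? ? ? ?; apply/andP; split; lra.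
Qed.

(** The set [S] stands for the part of the epigraph of [V] over the box that
    lies below some bound of [V] on its domain.  Its existence says at once that
    [V] is convex and lower semicontinuous on the box and that its domain there
    is closed. *)
Definition compact_epi b V : Prop :=
  exists2 S : set ('cV[R]_n * R^o), minimax_set S &
    (forall z, S z -> box b z.1 /\ (V z.1 <= (z.2 : R)%:E)%E) /\
    (forall x v, box b x -> V x = v%:E -> S (x, v)).

(** The induction hypothesis on V = V_(t+1) and D = D_t.  The minimum formula
    [dp_min] sees [V] on the box only; the minorants [dp_minor], which come from
    nearly optimal dual solutions, are valid on the whole space, as needed for
    the coperspective. *)
Record dual_pair b V (D : 'cV[R]_n -> R -> \bar R) : Prop := DualPair {
  dp_fin : forall x, (V x < +oo)%E -> exists v, V x = v%:E;
  dp_epi : compact_epi b V;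
  dp_min : forall p g, 0 <= g -> exists x v,
    [/\ box b x, V x = v%:E & D p g = (g * v - dot p x)%:E];
  dp_minor : forall p g a, 0 <= g -> (a%:E < D p g)%E ->
    exists zeta psi, [/\ p <=v zeta + psi, 0 <=v zeta &
      forall x v, V x = v%:E -> a + dot b zeta <= g * v - dot psi x]
}.

Lemma minorant_box b (zeta psi p x : 'cV[R]_n) (a g v : R) :
  p <=v zeta + psi -> 0 <=v zeta -> box b x ->
  a + dot b zeta <= g * v - dot psi x -> a <= g * v - dot p x.
Proof.
move=> pz z0 bx av.
have : dot (p - psi) x <= dot b zeta.
  by apply: dot_box_le => // i; have := pz i; rewrite !mxE lerBlDr.
by rewrite dotDl dotNl; lra.
Qed.

Lemma dp_le b V D p g x v : dual_pair b V D -> 0 <= g -> box b x ->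
  V x = v%:E -> (D p g <= (g * v - dot p x)%:E)%E.
Proof.
move=> dp g0 bx Vx; have [x1 [v1 [_ _ DE]]] := dp_min dp p g0.
rewrite DE lee_fin; apply/ler_addgt0Pr => e e0; rewrite -lerBlDr.
have /(dp_minor dp g0)[zeta [psi [pz z0 av]]] :
    ((g * v1 - dot p x1 - e)%:E < D p g)%E.
  by rewrite DE lte_fin ltrBlDr ltrDl.
exact: minorant_box pz z0 bx (av _ _ Vx).
Qed.

End DualPair.

(** * One stage of the recursions *)

Section Step.
Context {R : realType} {n n' ny m N : nat}.
Variables (A : 'I_N -> 'M[R]_(m, n')) (B : 'I_N -> 'M[R]_(m, n)).
Variables (T : 'I_N -> 'M[R]_(m, ny)) (c : 'I_N -> 'cV[R]_ny).
Variables (d : 'I_N -> 'cV[R]_m) (xbar : 'cV[R]_n) (xbar' : 'cV[R]_n').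
Variables (ybar : 'cV[R]_ny) (Q : set 'cV[R]_N).
Variables (V' : 'cV[R]_n' -> \bar R) (D' : 'cV[R]_n' -> R -> \bar R).

(** Unprimed data belong to the stage of the incoming state [x], primed data to
    the stage of the states [xs j] reached under the [j]-th realization. *)
Definition recourse_feasible (x : 'cV[R]_n) (xs : 'I_N -> 'cV[R]_n')
    (ys : 'I_N -> 'cV[R]_ny) : Prop :=
  forall j, [/\ A j *m xs j + B j *m x + T j *m ys j = d j,
    0 <=v xs j /\ xs j <=v xbar', 0 <=v ys j /\ ys j <=v ybar
    & (V' (xs j) < +oo)%E].

Definition recourse_risk (xs : 'I_N -> 'cV[R]_n') (ys : 'I_N -> 'cV[R]_ny) :
    \bar R :=
  risk Q (fun j => (dot (c j) (ys j))%:E + V' (xs j))%E.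

Definition primal_step (x : 'cV[R]_n) : \bar R :=
  ereal_inf [set v | exists xs ys,
    recourse_feasible x xs ys /\ v = recourse_risk xs ys].

Definition dual_step (p : 'cV[R]_n) (gamma : R) : \bar R :=
  ereal_sup [set v |
    exists (zeta : 'cV[R]_n) (gam : 'cV[R]_N) (lam : 'I_N -> 'cV[R]_m)
           (ps : 'I_N -> 'cV[R]_n') (xi : 'I_N -> 'cV[R]_ny),
    [/\ [set gamma *: q | q in Q] gam,
        p <=v zeta + \sum_j (B j)^T *m lam j,
        forall j, [/\ ps j + (A j)^T *m lam j = 0,
            0 <=v gam j 0 *: c j + (T j)^T *m lam j + xi j & 0 <=v xi j],
        0 <=v zeta
      & v = ((- dot xbar zeta)%:E +
             \sum_j ((- dot (d j) (lam j) - dot ybar (xi j))%:E +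
                     D' (ps j) (gam j 0)%R))%E]].

Hypothesis QA : ambiguity_set Q.
Hypothesis xbar0 : 0 <=v xbar.
Hypothesis ybar0 : 0 <=v ybar.
Hypothesis dp' : dual_pair xbar' V' D'.

(* A node is the next state, an upper bound on its cost-to-go, and the
   control. *)
Let node : lmodType R := (('cV[R]_n' * R^o) * 'cV[R]_ny)%type.
Let tree : lmodType R := ('cV[R]_n * ('I_N -> node))%type.

Let node_cost (j : 'I_N) (u : node) : R := dot (c j) u.2 + (u.1.2 : R).

Let residual (z : tree) (j : 'I_N) : 'cV[R]_m :=
  A j *m (z.2 j).1.1 + B j *m z.1 + T j *m (z.2 j).2 - d j.

Let lagrangian (gam : 'cV[R]_N) (lam : 'I_N -> 'cV[R]_m) (z : tree) : R :=
  \sum_j (gam j 0 * node_cost j (z.2 j) + dot (lam j) (residual z j)).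

Lemma affine_node_cost j : affine_form (node_cost j).
Proof.
apply: affine_formD.
  by apply/affine_form_dot/affine_map_snd/affine_map_id.
by apply: (@affine_map_snd _ _ _ R^o); exact/affine_map_fst/affine_map_id.
Qed.

Lemma affine_lagrangian gam lam : affine_form (lagrangian gam lam).
Proof.
have nodea j : affine_map (fun z : tree => z.2 j).
  by apply: affine_map_app; exact/affine_map_snd/affine_map_id.
apply: affine_form_sum => j; apply: affine_formD.
  apply: affine_formZ; exact: (affine_form_comp (affine_node_cost j)).
apply: affine_form_dot; apply: affine_mapD; last exact: affine_map_cst.
apply: affine_mapD; last by apply: affine_map_mulmx; exact: affine_map_snd.
apply: affine_mapD; apply: affine_map_mulmx.
  by apply: affine_map_fst; exact: affine_map_fst.
exact/affine_map_fst/affine_map_id.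
Qed.

Lemma lagrangianD gam gam' lam lam' z :
  lagrangian (gam + gam') (fun j => lam j + lam' j) z =
  lagrangian gam lam z + lagrangian gam' lam' z.
Proof.
rewrite /lagrangian -big_split /=; apply: eq_bigr => j _.
by rewrite mxE dotDl; ring.
Qed.

Lemma lagrangianZ a gam lam z :
  lagrangian (a *: gam) (fun j => a *: lam j) z = a * lagrangian gam lam z.
Proof.
rewrite /lagrangian mulr_sumr; apply: eq_bigr => j _.
by rewrite mxE dotZl; ring.
Qed.

Lemma lagrangian0 z : lagrangian 0 (fun=> 0) z = 0.
Proof.
by rewrite /lagrangian big1 // => j _; rewrite mxE dot0l mul0r addr0.
Qed.

Lemma lagrangian_feasible gam lam z : (forall j, residual z j = 0) ->
  lagrangian gam lam z = \sum_j gam j 0 * node_cost j (z.2 j).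
Proof.
by move=> z0; apply: eq_bigr => j _; rewrite z0 dot0r addr0.
Qed.

Let residual_eq0 z j : residual z j = 0 <->
  A j *m (z.2 j).1.1 + B j *m z.1 + T j *m (z.2 j).2 = d j.
Proof.
by split => /eqP; rewrite /residual ?subr_eq0 => /eqP// ->; rewrite subrr.
Qed.

(** A nonzero residual, taken as its own multiplier, makes the Lagrangian
    positive with weight t = 0; otherwise the weight is t = 1 and the risk alone
    decides. *)
Lemma lagrangian_sup z (g a : R) : 0 <= g ->
  ((forall j, residual z j = 0) ->
     exists2 q, Q q & a < g * \sum_j q j 0 * node_cost j (z.2 j)) ->
  exists t gam lam, [/\ t = 0 \/ t = 1, [set (t * g) *: q | q in Q] gam
    & t * a < lagrangian gam lam z].
Proof.
move=> g0 za.
have [z0|/existsNP[j zj]] := pselect (forall j, residual z j = 0).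
  have [q Qq aq] := za z0.
  exists 1, (g *: q), (fun=> 0); split; [by right|by exists q; rewrite ?mul1r|].
  rewrite lagrangian_feasible // mul1r; apply: lt_le_trans aq _.
  by rewrite mulr_sumr ler_sum // => i _; rewrite mxE mulrA.
exists 0, 0, (residual z); split; first by left.
  by rewrite mul0r; exact: ambiguity_scale0.
rewrite mul0r ltNge; apply/negP => zle; apply: zj; apply: dot_self_eq0.
apply: le_trans zle; rewrite /lagrangian (bigD1 j) //= mxE mul0r add0r lerDl.
apply: sumr_ge0 => i _; rewrite mxE mul0r add0r dotE.
by apply: sumr_ge0 => k _; rewrite -expr2 sqr_ge0.
Qed.

Lemma recourse_riskE x xs ys : recourse_feasible x xs ys ->
  exists2 vs : 'I_N -> R, forall j, V' (xs j) = (vs j)%:E &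
    recourse_risk xs ys = risk Q (fun j => (dot (c j) (ys j) + vs j)%:E).
Proof.
move=> xy; have /choice[vs vsP] : forall j, exists v, V' (xs j) = v%:E.
  by move=> j; have [_ _ _ /(dp_fin dp')] := xy j.
by exists vs => //; congr risk; apply/funext => j; rewrite vsP EFinD.
Qed.

Lemma recourse_risk_fin x xs ys : recourse_feasible x xs ys ->
  exists v, recourse_risk xs ys = v%:E.
Proof. by move=> /recourse_riskE[vs _ ->]; exact: risk_fin. Qed.

Section CompactNext.
Variable S' : set ('cV[R]_n' * R^o).
Hypothesis S'm : minimax_set S'.
Hypothesis S'V : forall z, S' z -> box xbar' z.1 /\ (V' z.1 <= (z.2 : R)%:E)%E.
Hypothesis VS' : forall x v, box xbar' x -> V' x = v%:E -> S' (x, v).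

Let nodes : set ('I_N -> node) :=
  [set p | forall j, (S' `*` box ybar) (p j)].

Lemma minimax_set_nodes : minimax_set nodes.
Proof.
apply: (@minimax_set_funord _ _ _ (fun=> S' `*` box ybar)) => _.
exact: (minimax_set_prod S'm (@minimax_set_box _ _ ybar)).
Qed.

Lemma node_cost_bounded : exists K,
  forall p, nodes p -> forall j, `|node_cost j (p j)| <= K.
Proof.
have /choice[K KP] : forall j, exists k, forall u,
    (S' `*` box ybar) u -> `|node_cost j u| <= k.
  move=> j; apply: minimax_set_bounded (affine_node_cost j).
  exact: (minimax_set_prod S'm (@minimax_set_box _ _ ybar)).
exists (\sum_j `|K j|) => p pP j.
apply: le_trans (KP _ _ (pP j)) _; apply: le_trans (ler_norm _) _.
by rewrite (bigD1 j) //= lerDl; exact: sumr_ge0.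
Qed.

Lemma nodes_feasible x p v : nodes p ->
  (forall j, residual (x, p) j = 0) ->
  (forall q, Q q -> \sum_j q j 0 * node_cost j (p j) <= v) ->
  recourse_feasible x (fun j => (p j).1.1) (fun j => (p j).2) /\
  (recourse_risk (fun j => (p j).1.1) (fun j => (p j).2) <= v%:E)%E.
Proof.
move=> pP p0 pv; split.
  move=> j; have [/S'V[bx Vx] by_] := pP j; split => //.
    exact/(residual_eq0 (x, p) j).
  exact: le_lt_trans Vx (ltry _).
apply: le_trans (risk_le pv); apply: le_risk_homo => // j.
by rewrite EFinD leeD2l //; have [/S'V[]] := pP j.
Qed.

Lemma feasible_nodes x xs ys : recourse_feasible x xs ys ->
  exists2 p, nodes p & (forall j, residual (x, p) j = 0) /\
    recourse_risk xs ys = risk Q (fun j => (node_cost j (p j))%:E).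
Proof.
move=> xy; have [vs vsP rE] := recourse_riskE xy.
exists (fun j => ((xs j, vs j), ys j)).
  by move=> j; have [_ bx by_ _] := xy j; split => //=; exact: VS'.
by split => // j; apply/residual_eq0; have [] := xy j.
Qed.

(** The graph of the recourse problem over the states of [C] is again a minimax
    set: its constraints say that all the Lagrangians are nonpositive, once the
    value is bounded by the costs of the nodes.  It is used with a singleton, to
    get optimal recourse decisions at any state, and with the box, to get the
    compact epigraph of the next value function in the induction. *)
Lemma compact_recourse (C : set 'cV[R]_n) : minimax_set C ->
  exists2 S : set ('cV[R]_n * R^o), minimax_set S &
    (forall z, S z -> C z.1 /\ exists xs ys, recourse_feasible z.1 xs ys /\
       (recourse_risk xs ys <= (z.2 : R)%:E)%E) /\
    (forall x xs ys v, C x -> recourse_feasible x xs ys ->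
       recourse_risk xs ys = v%:E -> S (x, v)).
Proof.
move=> Cm; have [K KP] := node_cost_bounded.
pose F : lmodType R := (tree * R^o)%type.
pose X : set F := (C `*` nodes) `*` [set v : R^o | - K <= (v : R) <= K].
pose G : set (F -> R) := [set g | exists t gam lam,
  [/\ 0 <= t, [set t *: q | q in Q] gam &
      g = (fun z => lagrangian gam lam z.1 - t * (z.2 : R))]].
have Gc : form_cone G.
  split.
  - move=> _ [t [gam [lam [_ _ ->]]]]; apply: affine_formB.
      apply: (affine_form_comp (affine_lagrangian gam lam)).
      exact/affine_map_fst/affine_map_id.
    by apply: affine_formZ; apply: (@affine_map_snd _ _ _ R^o);
       exact: affine_map_id.
  - exists 0, 0, (fun=> 0); split => //; first exact: ambiguity_scale0.
    by apply/funext => z; rewrite lagrangian0 mul0r subr0.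
  - move=> _ _ [t [gam [lam [t0 tg ->]]]] [t' [gam' [lam' [t0' tg' ->]]]].
    exists (t + t'), (gam + gam'), (fun j => lam j + lam' j).
    split; [exact: addr_ge0|exact: ambiguity_scaleD|].
    by apply/funext => z; rewrite lagrangianD; ring.
  - move=> a _ a0 [t [gam [lam [t0 tg ->]]]].
    exists (a * t), (a *: gam), (fun j => a *: lam j).
    split; [exact: mulr_ge0|exact: ambiguity_scaleZ|].
    by apply/funext => z; rewrite lagrangianZ; ring.
have Xm : minimax_set X.
  apply: minimax_set_prod; last exact: minimax_set_itv.
  exact: minimax_set_prod Cm minimax_set_nodes.
pose h (z : F) : 'cV[R]_n * R^o := (z.1.1, z.2).
have ha : affine_map h.
  apply: affine_map_pair; last exact/affine_map_snd/affine_map_id.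
  exact/affine_map_fst/affine_map_fst/affine_map_id.
exists (h @` [set z | X z /\ forall g, G g -> g z <= 0]).
  exact: minimax_set_image ha (minimax_set_constr Gc Xm).
split.
  move=> _ [[[x p] v] [[[/= Cx pP] vK] zG] <-] /=; split => //.
  exists (fun j => (p j).1.1), (fun j => (p j).2).
  have p0 j : residual (x, p) j = 0.
    apply: contrapT => pj.
    have [|t [gam [lam [t01 tg lt0]]]] :=
        @lagrangian_sup (x, p) 0 0 (lexx _).
      by move=> /(_ j)/pj.
    have := zG (fun z => lagrangian gam lam z.1 - 0 * (z.2 : R)).
    rewrite /= mul0r subr0 leNgt; move: lt0; rewrite mulr0 => -> /(_ _)/negP.
    apply => //; exists 0, gam, lam; split => //.
    by move: tg; rewrite mulr0.
  apply: nodes_feasible => // q Qq.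
  have := zG (fun z => lagrangian q (fun=> 0) z.1 - 1 * (z.2 : R)).
  rewrite /= lagrangian_feasible // mul1r subr_le0; apply.
  exists 1, q, (fun=> 0); split => //.
  by exists q => //; rewrite scale1r.
move=> x xs ys v Cx xy xyv; have [p pP [p0 pr]] := feasible_nodes xy.
rewrite pr in xyv.
have qv q : Q q -> \sum_j q j 0 * node_cost j (p j) <= v.
  by move=> Qq; rewrite -lee_fin -xyv; exact: le_risk.
exists ((x, p), v) => //; split.
  split => //=; have qK (s : R) q : Q q -> \sum_j q j 0 * s = s.
    by move=> Qq; rewrite -mulr_suml (ambiguity_prob QA Qq).2 mul1r.
  have q0 q j : Q q -> 0 <= q j 0.
    by move=> Qq; have := (ambiguity_prob QA Qq).1 j; rewrite mxE.
  apply/andP; split.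
    have [q Qq] := ambiguity_nonempty QA.
    apply: le_trans (qv _ Qq); rewrite -(qK (- K) _ Qq).
    apply: ler_sum => j _; apply: ler_wpM2l; first exact: q0.
    by have := KP p pP j; rewrite ler_norml => /andP[].
  rewrite -lee_fin -xyv; apply: risk_le => q Qq; rewrite -[leRHS](qK K _ Qq).
  apply: ler_sum => j _; apply: ler_wpM2l; first exact: q0.
  by have := KP p pP j; rewrite ler_norml => /andP[].
move=> _ [t [gam [lam [t0 [q Qq <-] ->]]]] /=.
rewrite lagrangian_feasible // subr_le0.
under eq_bigr => j _ do rewrite mxE -mulrA.
by rewrite -mulr_sumr; apply: ler_wpM2l => //; exact: qv.
Qed.

(** Strong duality: the Lagrangians shifted by the target value form a cone
    with a member positive at each decision, hence one of them is positive on
    all decisions.  A feasible decision shows that the weight [t] of the target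
    value in it is not zero, so that dividing by [t] gives the multipliers; the
    remaining dual variables are then read off the box of each primal
    variable. *)
Lemma dual_step_ge p g a a' : 0 <= g -> a' < a ->
  (exists x, box xbar x /\ (primal_step x < +oo)%E) ->
  (forall x v, box xbar x -> (primal_step x <= v%:E)%E ->
     a <= g * v - dot p x) ->
  (a'%:E <= dual_step p g)%E.
Proof.
move=> g0 a'a [x0 [bx0 x0f]] aV.
pose F : set (tree -> R) := [set f | exists t gam lam,
  [/\ 0 <= t, [set (t * g) *: q | q in Q] gam &
      f = (fun z => lagrangian gam lam z - t * (a' + dot p z.1))]].
have Fc : form_cone F.
  split.
  - move=> _ [t [gam [lam [_ _ ->]]]].
    apply: affine_formB (affine_lagrangian _ _) _.
    apply/affine_formZ/affine_formD; first exact: affine_form_cst.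
    exact/affine_form_dot/affine_map_fst/affine_map_id.
  - exists 0, 0, (fun=> 0); split => //.
      by rewrite mul0r; exact: ambiguity_scale0.
    by apply/funext => z; rewrite lagrangian0 mul0r subr0.
  - move=> _ _ [t [gam [lam [t0 tg ->]]]] [t' [gam' [lam' [t0' tg' ->]]]].
    exists (t + t'), (gam + gam'), (fun j => lam j + lam' j).
    split; [exact: addr_ge0| |].
      by rewrite mulrDl; apply: ambiguity_scaleD => //; exact: mulr_ge0.
    by apply/funext => z; rewrite lagrangianD; ring.
  - move=> s _ s0 [t [gam [lam [t0 tg ->]]]].
    exists (s * t), (s *: gam), (fun j => s *: lam j).
    split; [exact: mulr_ge0|by rewrite -mulrA; exact: ambiguity_scaleZ|].
    by apply/funext => z; rewrite lagrangianZ; ring.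
have Xm := minimax_set_prod (@minimax_set_box _ _ xbar) minimax_set_nodes.
have [|_ [e [[t [gam [lam [t0 tg ->]]]] e0 fX]]] := Xm F Fc.
  move=> [x q] [/= bx qP].
  have [|t [gam [lam [t01 tg tlt]]]] :=
      @lagrangian_sup (x, q) g (a' + dot p x) g0.
    move=> r0; have [rho rhoE] := risk_fin (fun j => node_cost j (q j)) QA.
    have le_rho r : Q r -> \sum_j r j 0 * node_cost j (q j) <= rho.
      by move=> Qr; rewrite -lee_fin -rhoE; exact: le_risk.
    have [xy rle] := nodes_feasible qP r0 le_rho.
    have Vle : (primal_step x <= rho%:E)%E.
      apply: le_trans rle; apply: ereal_inf_lbound.
      by exists (fun j => (q j).1.1), (fun j => (q j).2).
    have lt_rho : a' + dot p x < g * rho by have := aV _ _ bx Vle; lra.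
    have [gE|gn0] := eqVneq g 0.
      have [r Qr] := ambiguity_nonempty QA; exists r => //.
      by move: lt_rho; rewrite gE !mul0r.
    have gp : 0 < g by rewrite lt0r gn0.
    apply: contrapT => noq.
    suff : rho <= (a' + dot p x) / g by rewrite ler_pdivlMr // mulrC; lra.
    rewrite -lee_fin -rhoE; apply: risk_le => r Qr.
    rewrite ler_pdivlMr // mulrC leNgt; apply/negP => rlt.
    by apply: noq; exists r.
  exists (fun z => lagrangian gam lam z - t * (a' + dot p z.1)).
    by exists t, gam, lam; split => //; case: t01 => ->.
  by rewrite subr_gt0.
have tp : 0 < t.
  rewrite lt0r t0 andbT; apply/eqP => t_eq0.
  have /ereal_inf_lt[_ [xs [ys [xy _]]] _] := x0f.
  have [q qP [r0 _]] := feasible_nodes xy.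
  have := fX (x0, q) (conj bx0 qP); rewrite lagrangian_feasible //.
  case: tg => r _ <-; rewrite t_eq0 !mul0r scale0r big1 => [|j _].
    by lra.
  by rewrite mxE mul0r.
pose gam1 := t^-1 *: gam; pose lam1 j := t^-1 *: lam j.
have gQ : [set g *: q | q in Q] gam1.
  by have := ambiguity_scaleZ t^-1 tg; rewrite mulKf ?gt_eqF.
have gam1_ge0 := ambiguity_scale_ge0 QA g0 gQ.
have {}fX z : (box xbar `*` nodes) z ->
    a' + dot p z.1 <= lagrangian gam1 lam1 z.
  move=> /fX fz; rewrite lagrangianZ mulrC ler_pdivlMr // mulrC.
  by rewrite -subr_ge0; exact: le_trans (ltW e0) fz.
pose psi := \sum_j (B j)^T *m lam1 j.
pose red j := gam1 j 0 *: c j + (T j)^T *m lam1 j.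
pose ps j := - ((A j)^T *m lam1 j).
(* The decisions below attain the positive parts zeta and xi and the dual value
   functions of the next stage, so that the form at this single decision is the
   dual objective. *)
have [x bx xE] := @dot_box_max _ _ xbar (p - psi) xbar0.
have /choice[ys ysP] : forall j, exists y, box ybar y /\
    dot (- red j) y = dot ybar (pospart (- red j)).
  by move=> j; have [y] := @dot_box_max _ _ ybar (- red j) ybar0; exists y.
have /choice[xvs xvsP] : forall j, exists xv : 'cV[R]_n' * R,
    [/\ box xbar' xv.1, V' xv.1 = xv.2%:E &
        D' (ps j) (gam1 j 0) = (gam1 j 0 * xv.2 - dot (ps j) xv.1)%:E].
  move=> j; have [x' [v' h]] := dp_min dp' (ps j) (gam1_ge0 j).
  by exists (x', v').
pose q j : node := (xvs j, ys j).
have qP : nodes q.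
  move=> j; have [bx' Vx' _] := xvsP j; have [by_ _] := ysP j.
  by split => //=; rewrite [xvs j]surjective_pairing; exact: VS'.
have := fX (x, q) (conj bx qP) => /= a'le.
apply: (@le_trans _ _ ((- dot xbar (pospart (p - psi)))%:E +
  \sum_j ((- dot (d j) (lam1 j) - dot ybar (pospart (- red j)))%:E +
     D' (ps j) (gam1 j 0)%R))%E); last first.
  apply: ereal_sup_ubound.
  exists (pospart (p - psi)), gam1, lam1, ps, (fun j => pospart (- red j)).
  split => //; last exact: pospart_ge0.
    by move=> i; have := le_pospart (p - psi) i; rewrite !mxE; lra.
  move=> j; split; [by rewrite /ps addNr| |exact: pospart_ge0].
  by move=> i; have := le_pospart (- red j) i; rewrite !mxE; lra.
rewrite (eq_bigr (fun j => (- dot (d j) (lam1 j) -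
    dot ybar (pospart (- red j)) +
    (gam1 j 0 * (xvs j).2 - dot (ps j) (xvs j).1))%:E)); last first.
  by move=> j _; have [_ _ ->] := xvsP j.
rewrite sumEFin -EFinD lee_fin -xE dotDl dotNl.
have : lagrangian gam1 lam1 (x, q) = dot psi x +
    \sum_j (- dot (d j) (lam1 j) - dot ybar (pospart (- red j)) +
      (gam1 j 0 * (xvs j).2 - dot (ps j) (xvs j).1)).
  rewrite /psi dot_suml -big_split /=; apply: eq_bigr => j _.
  have [_ <-] := ysP j; rewrite /residual /node_cost /= /ps /red.
  rewrite !dotNl !dotDl (dotZl _ (c j)) !dotDr dotNr !dot_trmx (dotC (d j)).
  ring.
by lra.
Qed.

End CompactNext.

Lemma primal_step_attained x : (primal_step x < +oo)%E ->
  exists v xs ys, [/\ primal_step x = v%:E, recourse_feasible x xs ys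
    & recourse_risk xs ys = v%:E].
Proof.
move=> /ereal_inf_lt[_ [xs [ys [xy _]]] _].
have [S' S'm [S'V VS']] := dp_epi dp'.
have [S Sm [SC CS]] := compact_recourse S'm S'V VS' (@minimax_set1 _ _ x).
have [r rE] := recourse_risk_fin xy.
have [|[x1 v] Sv vmin] := minimax_set_min Sm (f := fun z => z.2) _
    (ex_intro _ _ (CS _ _ _ _ erefl xy rE)).
  by apply: (@affine_map_snd _ _ _ R^o); exact: affine_map_id.
have /= [x1x [xs1 [ys1 [xy1 r1le]]]] := SC _ Sv.
rewrite x1x in xy1.
have vle xs2 ys2 : recourse_feasible x xs2 ys2 ->
    (v%:E <= recourse_risk xs2 ys2)%E.
  move=> xy2; have [r2 r2E] := recourse_risk_fin xy2.
  by rewrite r2E lee_fin; exact: vmin (CS _ _ _ _ erefl xy2 r2E).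
have r1E : recourse_risk xs1 ys1 = v%:E.
  by apply/eqP; rewrite eq_le r1le vle.
exists v, xs1, ys1; split => //; apply/eqP; rewrite eq_le; apply/andP; split.
  by rewrite -r1E; apply: ereal_inf_lbound; exists xs1, ys1.
by apply: le_ereal_inf_tmp => _ [xs2 [ys2 [xy2 ->]]]; exact: vle.
Qed.

(** Weak duality at every state, inside the box or not: each control and next
    state is bounded below by its own dual constraint, and the state [x] is left
    with the linear term in B_j x. *)
Lemma dual_step_weak x v g gam lam ps xi : 0 <= g ->
  primal_step x = v%:E -> [set g *: q | q in Q] gam ->
  (forall j, [/\ ps j + (A j)^T *m lam j = 0,
     0 <=v gam j 0 *: c j + (T j)^T *m lam j + xi j & 0 <=v xi j]) ->
  (\sum_j ((- dot (d j) (lam j) - dot ybar (xi j))%:E +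
           D' (ps j) (gam j 0)%R) <=
   (g * v - dot (\sum_j (B j)^T *m lam j) x)%:E)%E.
Proof.
move=> g0 Vx gQ feas.
have [|v1 [xs [ys [Vx1 xy rE]]]] := @primal_step_attained x.
  by rewrite Vx ltry.
move: Vx1; rewrite Vx => -[vE]; rewrite -{}vE in rE.
have [vs vsE rE'] := recourse_riskE xy.
have gam0 := ambiguity_scale_ge0 QA g0 gQ.
have nodele j : ((- dot (d j) (lam j) - dot ybar (xi j))%:E +
     D' (ps j) (gam j 0)%R <= (gam j 0 * (dot (c j) (ys j) + vs j) -
     dot (lam j) (B j *m x))%:E)%E.
  have [eqn bx by_ _] := xy j; have [psE redE xi0] := feas j.
  have := dp_le (ps j) dp' (gam0 j) bx (vsE j).
  have -> : dot (ps j) (xs j) = - dot (lam j) (A j *m xs j).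
    by rewrite -dot_trmx -dotNl; congr dot; apply/eqP; rewrite -addr_eq0 psE.
  move=> /(leeD2l (- dot (d j) (lam j) - dot ybar (xi j))%:E) /le_trans; apply.
  rewrite -EFinD lee_fin -eqn (dotC _ (lam j)) !dotDr.
  have := dot_ge0 redE by_.1; rewrite !dotDl dotZl dot_trmx.
  have := dot_le xi0 by_.2; rewrite !(dotC (xi j)) (dotC ybar).
  lra.
apply: le_trans (lee_sum _ (fun j _ => nodele j)) _.
rewrite sumEFin lee_fin sumrB dot_suml.
under [X in _ <= _ - X]eq_bigr => j _ do rewrite dot_trmx.
rewrite lerD2r; case: gQ => q Qq <-.
under eq_bigr => j _ do rewrite mxE -mulrA.
rewrite -mulr_sumr; apply: ler_wpM2l => //.
by rewrite -lee_fin -rE rE'; exact: le_risk.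
Qed.

Lemma dual_pair_step :
  (exists x, box xbar x /\ (primal_step x < +oo)%E) ->
  dual_pair xbar primal_step dual_step.
Proof.
move=> ne; have [S' S'm [S'V VS']] := dp_epi dp'.
have Vfin x : (primal_step x < +oo)%E -> exists v, primal_step x = v%:E.
  by move=> /primal_step_attained[v [_ [_ [-> _ _]]]]; exists v.
have [S Sm [SC CS]] := compact_recourse S'm S'V VS' (@minimax_set_box _ _ xbar).
have SV z : S z -> box xbar z.1 /\ (primal_step z.1 <= (z.2 : R)%:E)%E.
  move=> /SC[bz [xs [ys [xy rle]]]]; split => //.
  by apply: le_trans rle; apply: ereal_inf_lbound; exists xs, ys.
have VS x v : box xbar x -> primal_step x = v%:E -> S (x, v).
  move=> bx Vx; have [|v1 [xs [ys [Vx1 xy rE]]]] := @primal_step_attained x.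
    by rewrite Vx ltry.
  by apply: CS bx xy _; rewrite rE -Vx1.
have [x0 [bx0 x0f]] := ne; have [v0 Vx0] := Vfin _ x0f.
split => //; first by exists S.
  move=> p g g0.
  have [|[x v1] Sx xmin] := minimax_set_min Sm
      (f := fun z => g * (z.2 : R) - dot p z.1) _
      (ex_intro _ _ (VS _ _ bx0 Vx0)).
    apply: affine_formB.
      apply: affine_formZ; apply: (@affine_map_snd _ _ _ R^o).
      exact: affine_map_id.
    exact/affine_form_dot/affine_map_fst/affine_map_id.
  have [/= bx Vle] := SV _ Sx.
  have [v Vx] := Vfin _ (le_lt_trans Vle (ltry _)).
  have vmin x' v' : box xbar x' -> (primal_step x' <= v'%:E)%E ->
      g * v - dot p x <= g * v' - dot p x'.
    move=> bx' Vle'; have [u Vx'] := Vfin _ (le_lt_trans Vle' (ltry _)).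
    have vv1 : v <= v1 by rewrite -lee_fin -Vx.
    have uv' : u <= v' by rewrite -lee_fin -Vx'.
    by have := xmin _ (VS _ _ bx' Vx') => /=; nra.
  exists x, v; split => //; apply/eqP; rewrite eq_le; apply/andP; split.
    apply: ge_ereal_sup => _ [zeta [gam [lam [ps [xi [gQ pz feas z0 ->]]]]]].
    have := dual_step_weak g0 Vx gQ feas.
    move=> /(leeD2l (- dot xbar zeta)%:E) /le_trans; apply.
    rewrite -EFinD lee_fin.
    apply: (minorant_box pz z0 bx); first by rewrite addrAC addNr add0r.
  apply/lee_addgt0Pr => e e0; rewrite -leeBlDr //.
  apply: (dual_step_ge S'm S'V VS' g0 _ ne vmin).
  by rewrite ltrBlDr ltrDl.
move=> p g a g0 /ereal_sup_gt[_ [zeta [gam [lam [ps [xi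
  [gQ pz feas z0 ->]]]]]]] aD.
exists zeta, (\sum_j (B j)^T *m lam j); split => // x v Vx.
have := dual_step_weak g0 Vx gQ feas.
move=> /(leeD2l (- dot xbar zeta)%:E) /(lt_le_trans aD).
by rewrite -EFinD lte_fin => /ltW; lra.
Qed.

End Step.
(** * The coperspective *)

Section Coperspective.
Context {R : realType} {n : nat}.
Variable V : 'cV[R]_n -> \bar R.

Lemma le_conjugate z x v : V x = v%:E ->
  ((dot z x - v)%:E <= conjugate V z)%E.
Proof.
by move=> Vx; apply: ereal_sup_ubound; exists x => //; rewrite Vx EFinB.
Qed.

Lemma conjugate_le z r : (forall x, (V x < +oo)%E -> exists v, V x = v%:E) ->
  (forall x v, V x = v%:E -> dot z x - v <= r) -> (conjugate V z <= r%:E)%E.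
Proof.
move=> Vfin Vr; apply: ge_ereal_sup => _ [x _ <-].
have [/Vfin[v Vx]|] := ltP (V x) +oo%E.
  by rewrite Vx -EFinB lee_fin; exact: Vr.
by rewrite leye_eq => /eqP ->; rewrite addeNy leNye.
Qed.

(** With [le_coperspective], this treats all gamma >= 0 alike: at gamma = 0 the
    recession function of the conjugate is the support function of the domain
    of [V], which is the formula for gamma > 0 without its second term. *)
Lemma coperspective_le psi g r : 0 <= g ->
  (forall x, (V x < +oo)%E -> exists v, V x = v%:E) ->
  (forall x v, V x = v%:E -> dot psi x - g * v <= r) ->
  (coperspective V psi g <= r%:E)%E.
Proof.
move=> g0 Vfin Vr; rewrite /coperspective.
have [gp|] := ltP 0 g.
  rewrite -lee_pdivlMl //; apply: conjugate_le => // x v Vx.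
  have := Vr x v Vx; rewrite dotZl ler_pdivlMl // mulrBr mulrA divff ?mul1r //.
  exact: lt0r_neq0.
move=> gn; have /eqP g_eq0 : g == 0 by rewrite eq_le gn.
rewrite {}g_eq0 in Vr *; rewrite eqxx; apply: ereal_inf_lbound.
exists r => // z s a a0 zs; apply: conjugate_le => // x v Vx.
have := le_trans (le_conjugate z Vx) zs; rewrite lee_fin dotDl dotZl.
by have := Vr x v Vx; rewrite mul0r subr0; nra.
Qed.

Lemma le_coperspective psi g x v z s : 0 <= g -> V x = v%:E ->
  (conjugate V z <= s%:E)%E ->
  ((dot psi x - g * v)%:E <= coperspective V psi g)%E.
Proof.
move=> g0 Vx zs; rewrite /coperspective.
have [gp|] := ltP 0 g.
  rewrite -lee_pdivrMl //; apply: le_trans (le_conjugate _ Vx).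
  by rewrite lee_fin dotZl mulrBr mulrA mulVf ?mul1r // lt0r_neq0.
move=> gn; have /eqP -> : g == 0 by rewrite eq_le gn.
rewrite eqxx mul0r subr0; apply: le_ereal_inf_tmp => _ [mu muP <-].
rewrite lee_fin leNgt; apply/negP => mulow.
have k0 : 0 < dot psi x - mu by rewrite subr_gt0.
(* far enough along the direction psi *)
pose a := (`|s - dot z x + v| + 1) / (dot psi x - mu).
have a0 : 0 <= a by rewrite divr_ge0 ?(ltW k0) // addr_ge0.
have := le_trans (le_conjugate _ Vx) (muP z s a a0 zs).
rewrite lee_fin dotDl dotZl => h.
have : a * (dot psi x - mu) = `|s - dot z x + v| + 1.
  by rewrite /a divfK // lt0r_neq0.
have := ler_norm (s - dot z x + v); nra.
Qed.

End Coperspective.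

(** * Consequences of the duality formula *)

Section DualPairTheory.
Context {R : realType} {n : nat}.
Variables (b : 'cV[R]_n) (V : 'cV[R]_n -> \bar R).
Variable D : 'cV[R]_n -> R -> \bar R.

Lemma dual_pair_base : 0 <=v b ->
  dual_pair b (fun=> 0%E) (fun p _ => (- dot b (pospart p))%:E).
Proof.
move=> b0; split.
- by move=> x _; exists 0.
- exists (box b `*` [set (0 : R^o)]).
    exact: (minimax_set_prod (@minimax_set_box _ _ b) (@minimax_set1 _ R^o 0)).
  by split => [[x v] [/= bx ->]|x v bx [<-]].
- move=> p g _; have [x bx xE] := dot_box_max p b0.
  by exists x, 0; split => //; rewrite xE mulr0 sub0r.
- move=> p g a _; rewrite lte_fin => ap.
  exists (pospart p), 0; split => [i|| x v [<-]]; last 1 first.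
  + by rewrite mulr0 dot0l subrr; lra.
  + by rewrite addr0; exact: le_pospart.
  + exact: pospart_ge0.
Qed.

Hypothesis dp : dual_pair b V D.

Lemma dp_concave : concave_on_nneg D.
Proof.
move=> p1 p2 g1 g2 a g10 g20 /andP[a0 a1].
have a1' : 0 <= 1 - a by rewrite subr_ge0.
have g0 : 0 <= a * g1 + (1 - a) * g2 by rewrite addr_ge0 // mulr_ge0.
have [x [v [bx Vx ->]]] := dp_min dp (a *: p1 + (1 - a) *: p2) g0.
apply: (@le_trans _ _ (a%:E * (g1 * v - dot p1 x)%:E +
                       (1 - a)%:E * (g2 * v - dot p2 x)%:E)%E).
  by apply: leeD; apply: lee_wpmul2l; rewrite ?lee_fin //;
     apply: dp_le dp _ bx Vx.
rewrite -!EFinM -EFinD lee_fin dotDl !dotZl.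
by rewrite le_eqVlt; apply/orP; left; apply/eqP; ring.
Qed.

Lemma dp_pos_homogeneous : pos_homogeneous_on_nneg D.
Proof.
move=> p g a g0 a0; have ag0 : 0 <= a * g by rewrite mulr_ge0 // ltW.
have [x [v [bx Vx DE]]] := dp_min dp p g0.
have [y [u [by_ Vy DE']]] := dp_min dp (a *: p) ag0.
have := dp_le (a *: p) dp ag0 bx Vx; have := dp_le p dp g0 by_ Vy.
rewrite DE DE' -EFinM !lee_fin !dotZl => h1 h2.
congr EFin; apply/eqP; rewrite eq_le; apply/andP; split; last by nra.
by apply: le_trans h2 _; rewrite le_eqVlt; apply/orP; left; apply/eqP; ring.
Qed.

Lemma dp_conjugate_fin : exists z s, (conjugate V z <= s%:E)%E.
Proof.
have [x [v [_ _ DE]]] := dp_min dp 0 ler01.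
have /(dp_minor dp ler01)[zeta [psi [_ _ av]]] :
    ((1 * v - dot 0 x - 1)%:E < D 0 1)%E.
  by rewrite DE lte_fin ltrBlDr ltrDl.
exists psi, (- (1 * v - dot 0 x - 1) - dot b zeta).
apply: conjugate_le (dp_fin dp) _ => y u Vy.
by have := av y u Vy; lra.
Qed.

Lemma dp_lipschitz_reg p g : 0 <= g ->
  lipschitz_reg b (coperspective V) p g = (- D p g)%E.
Proof.
move=> g0; have [x [v [bx Vx DE]]] := dp_min dp p g0.
have [z [s zs]] := dp_conjugate_fin.
rewrite DE -EFinN; apply/eqP; rewrite eq_le; apply/andP; split.
  apply/lee_addgt0Pr => e e0.
  have /(dp_minor dp g0)[zeta [psi [pz z0 av]]] :
      ((g * v - dot p x - e)%:E < D p g)%E.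
    by rewrite DE lte_fin ltrBlDr ltrDl.
  have le_psi : (coperspective V psi g <=
      (- (g * v - dot p x - e) - dot b zeta)%:E)%E.
    apply: coperspective_le g0 (dp_fin dp) _ => y u Vy.
    by have := av y u Vy; lra.
  apply: (@le_trans _ _ ((dot b zeta)%:E + coperspective V psi g)%E).
    by apply: ereal_inf_lbound; exists zeta, psi.
  apply: le_trans (leeD2l _ le_psi) _.
  by rewrite -!EFinD lee_fin; lra.
apply: le_ereal_inf_tmp => _ [zeta [psi [pz z0 ->]]].
apply: le_trans (leeD2l _ (le_coperspective psi g0 Vx zs)).
rewrite -EFinD lee_fin.
have : dot (p - psi) x <= dot b zeta.
  by apply: dot_box_le => // i; have := pz i; rewrite !mxE lerBlDr.
by rewrite dotDl dotNl; lra.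
Qed.

(** On the compact epigraph of [V], points over another state than [x] are
    separated from (x, V x - e) by their own direction, and points over [x] by
    their height; a single form does both, and its weight [t] on the height is
    positive because it is positive at (x, V x). *)
Lemma dp_biconjugate x : box b x -> (V x < +oo)%E ->
  V x = ereal_sup [set ((dot p x)%:E + D p 1)%E | p in [set: 'cV[R]_n]].
Proof.
move=> bx /(dp_fin dp)[v Vx]; rewrite Vx.
apply/eqP; rewrite eq_le; apply/andP; split; last first.
  apply: ge_ereal_sup => _ [p _ <-].
  apply: le_trans (leeD2l _ (dp_le p dp ler01 bx Vx)) _.
  by rewrite -EFinD lee_fin; lra.
apply/lee_addgt0Pr => e e0.
have [S Sm [SV VS]] := dp_epi dp.
pose F : set ('cV[R]_n * R^o -> R) := [set f | exists t p, 0 <= t /\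
  f = (fun z => t * ((z.2 : R) - (v - e)) + dot p (x - z.1))].
have [||_ [e' [[t [p [t0 ->]]] e'0 fS]]] := Sm F.
- split.
  + move=> _ [t [p [_ ->]]]; apply: affine_formD.
      apply: affine_formZ; apply: affine_formB (affine_form_cst _).
      by apply: (@affine_map_snd _ _ _ R^o); exact: affine_map_id.
    apply: affine_form_dot => s y z.
    rewrite /= !scalerBr addrACA -scalerDl (addrC s) subrK scale1r.
    by rewrite opprD.
  + exists 0, 0; split => //.
    by apply/funext => z; rewrite mul0r dot0l addr0.
  + move=> _ _ [t [p [t0 ->]]] [t' [p' [t0' ->]]].
    exists (t + t'), (p + p'); split; first exact: addr_ge0.
    by apply/funext => z; rewrite dotDl; ring.
  + move=> a _ a0 [t [p [t0 ->]]].
    exists (a * t), (a *: p); split; first exact: mulr_ge0.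
    by apply/funext => z; rewrite dotZl; ring.
- move=> [y u] Syu; have [/eqP|yx] := eqVneq (x - y) 0.
    rewrite subr_eq0 => /eqP xy; rewrite -xy in Syu.
    have [_] := SV _ Syu; rewrite /= Vx lee_fin => vu.
    exists (fun z => 1 * ((z.2 : R) - (v - e)) + dot 0 (x - z.1)).
      by exists 1, 0.
    by rewrite /= dot0l; lra.
  exists (fun z => 0 * ((z.2 : R) - (v - e)) + dot (x - y) (x - z.1)).
    by exists 0, (x - y).
  rewrite /= mul0r add0r ltNge; apply/negP => /dot_self_eq0 xy.
  by rewrite xy eqxx in yx.
have tp : 0 < t.
  have := fS _ (VS _ _ bx Vx); rewrite /= subrr dot0r.
  by rewrite lt0r t0 andbT; case: eqVneq => // ->; lra.
have [y [u [by_ Vy DE]]] := dp_min dp (t^-1 *: p) ler01.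
apply: (@le_trans _ _ (((dot (t^-1 *: p) x)%:E + D (t^-1 *: p) 1) + e%:E)%E).
  rewrite DE -!EFinD lee_fin !dotZl.
  have := fS _ (VS _ _ by_ Vy); rewrite /= dotBr => fy.
  have h : - (t^-1 * (dot p x - dot p y)) <= u - (v - e).
    by rewrite lerNl ler_pdivlMl // mulrN; lra.
  lra.
by rewrite leeD2r //; apply: ereal_sup_ubound; exists (t^-1 *: p).
Qed.

End DualPairTheory.
(** * Backward induction on the stages *)

Section Stages.
Context {R : realType}.
Variable M : mslp R.
Hypothesis M_wf : mslp_wf M.

Lemma ambiguity_riskset t : stage M t -> ambiguity_set (riskset M t).
Proof.
move=> st; apply: ambiguity_conv_hull; first exact (riskgen_neq0 M_wf st).
exact (riskgen_prob M_wf st).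
Qed.

Lemma primal_recS k t x : primal_rec M k.+1 t x =
  primal_step (matA M) (matB M) (matT M) (cost M) (rhs M)
    (xmax M t) (ymax M t) (riskset M t) (primal_rec M k t.+1) x.
Proof. by []. Qed.

Lemma stageS t k : (t + k.+1 = horizon M)%N -> stage M t.+1.
Proof. by rewrite /stage /= => <-; rewrite addnS ltnS leq_addr. Qed.

(** A feasible state of the box at one stage leads to one at the next stage,
    as a risk set of probability vectors leaves at least one realization. *)
Lemma primal_rec_next k t x : (t + k.+1 = horizon M)%N ->
  (primal_rec M k.+1 t.+1 x < +oo)%E ->
  exists x', box (xmax M t.+1) x' /\ (primal_rec M k t.+2 x' < +oo)%E.
Proof.
move=> tk /ereal_inf_lt[_ [xs [ys [xy _]]] _].
have [[q Qq] qP _] := ambiguity_riskset (stageS tk).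
have [j] := prob_vector_inhab (qP _ Qq).
by exists (xs j); have [_ bx _ Vx] := xy j.
Qed.

Lemma dual_pair_rec k t : (t + k = horizon M)%N ->
  (exists x, box (xmax M t) x /\ (primal_rec M k t.+1 x < +oo)%E) ->
  dual_pair (xmax M t) (primal_rec M k t.+1) (dual_rec M k t).
Proof.
elim: k t => [|k IH] t tk ne.
  by apply: dual_pair_base; apply: xmax_ge0 => //; rewrite -tk leq_addr.
have st := stageS tk; have [x [_ Vx]] := ne.
apply: dual_pair_step ne.
- exact: ambiguity_riskset.
- by apply: xmax_ge0 => //; rewrite -tk leq_addr.
- exact: ymax_ge0.
- by apply: IH; [rewrite addSnnS|exact: primal_rec_next tk Vx].
Qed.

Hypothesis V1_fin : (primal_rec M (horizon M) 1 (xinit M) < +oo)%E.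

Lemma primal_rec_nonempty k t : (t + k = horizon M)%N ->
  exists x, box (xmax M t) x /\ (primal_rec M k t.+1 x < +oo)%E.
Proof.
elim: t k => [|t IH] k tk.
  exists (xinit M); split; last by rewrite -[k]add0n tk.
  by split; [exact: xinit_ge0|exact: xinit_le].
have tk' : (t + k.+1 = horizon M)%N by rewrite -addSnnS.
have [x [_ Vx]] := IH _ tk'; exact: primal_rec_next tk' Vx.
Qed.

Lemma stage_dual_pair k t : (t + k = horizon M)%N ->
  dual_pair (xmax M t) (primal_rec M k t.+1) (dual_rec M k t).
Proof. by move=> tk; apply: dual_pair_rec => //; exact: primal_rec_nonempty. Qed.

End Stages.

(** * Dynamic programming for policies *)

Section Policies.
Context {R : realType} {M : mslp R} {disp : measure_display}.
Context {Omega : measurableType disp} {P : probability Omega R}.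
Variable w : forall t, Omega -> 'I_(nscen M t).
Hypotheses (M_wf : mslp_wf M) (w_wf : noise_wf P w).

(** The set from which the conditional risk measure chooses an outcome. *)
Let continuation t (j : 'I_(nscen M t)) (s : Omega) : set Omega :=
  [set s' | w t s' = j /\ forall k, (1 <= k < t)%N -> w k s' = w k s].

(** By independence every combination of points of the supports has positive
    probability. *)
Lemma continuation_neq0 t (j : 'I_(nscen M t)) s : stage M t ->
  exists s', continuation j s s'.
Proof.
move=> st.
have pos_ex (A : set Omega) : (0 < P A)%E -> exists s, A s.
  move=> PA; apply/set0P/eqP => A0; move: PA.
  by rewrite A0 measure0 ltxx.
have [s1 ws1] := pos_ex _ (noise_support w_wf j st).
pose E k : set 'I_(nscen M k) := [set if (k < t)%N then w k s else w k s1].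
have [s' Es'] : exists s', (\bigcap_(k in stage M) (w k @^-1` E k)) s'.
  apply: pos_ex; rewrite (noise_indep w_wf) big_nat.
  elim/big_ind: _ => // [x y x0 y0|k kh]; first exact: mule_gt0.
  exact: (noise_support w_wf _ kh).
exists s'; split; first by have := Es' t st; rewrite /E /= ltnn ws1.
move=> k /andP[k1 kt]; have kst : stage M k.
  by rewrite /stage /= k1 (leq_trans (ltnW kt)) //; case/andP: st.
by have := Es' k kst; rewrite /E /= kt.
Qed.

Lemma xget_continuation t (j : 'I_(nscen M t)) s : stage M t ->
  continuation j s (xget s (continuation j s)).
Proof. by move=> st; apply: xgetPex; exact: continuation_neq0. Qed.

(** Sets that do not distinguish [s] from [s'] form a sigma-algebra. *)
Lemma adapted_history t n (f : Omega -> 'cV[R]_n) s s' : adapted w t f ->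
  (forall k, (1 <= k <= t)%N -> w k s = w k s') -> f s = f s'.
Proof.
move=> fa ss'; apply/colP => i.
pose C : set (set Omega) := [set A | A s <-> A s'].
have CG : <<s history_events w t >> `<=` C.
  apply: smallest_sub; last first.
    by move=> _ [k [A [kt ->]]]; rewrite /C /= ss'.
  split => [|A CA|F CF]; rewrite /C /= //.
    by split => -[_ nA]; split => // /CA.
  by split => -[k _ Fk]; exists k => //; exact/CF.
have [h _] : C ((fun s => f s i 0) @^-1` [set f s i 0]).
  apply: CG; have := fa i measurableT [set f s i 0] (measurable_set1 _).
  by rewrite setTI.
exact/esym/h.
Qed.

Lemma feasible_history x y t s s' : feasible w x y -> stage M t ->
  (forall k, (1 <= k < t)%N -> w k s = w k s') -> x t.-1 s = x t.-1 s'.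
Proof.
move=> [x0 xyF]; case: t => [|[|t]] // st ss'; first by rewrite !x0.
have st' : stage M t.+1 by move: st; rewrite /stage /= => /ltnW.
have [xa _ _] := xyF _ st'.
by apply: adapted_history xa _ => k kt; exact: ss'.
Qed.

Lemma nested_riskS y k t s : nested_risk w y k.+1 t s =
  risk (riskset M t) (fun j => let s' := xget s (continuation j s) in
    (dot (cost M (w t s')) (y t s'))%:E + nested_risk w y k t.+1 s')%E.
Proof. by []. Qed.

(** Along a feasible policy, the decisions at stage [t], seen as a function of
    the noise at stage [t] only, are feasible for the problem that defines the
    value function.  Finiteness of the nested risk is carried along because that
    problem requires finite values of the next value function. *)
Lemma primal_rec_le_nested x y k t s : feasible w x y ->
  (1 <= t)%N -> (t + k = (horizon M).+1)%N ->
  (primal_rec M k t (x t.-1 s) <= nested_risk w y k t s)%E /\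
  exists r, nested_risk w y k t s = r%:E.
Proof.
move=> xyF; elim: k t s => [|k IH] t s t1 tk; first by split => //; exists 0.
have st : stage M t.
  by rewrite /stage /= t1 -ltnS -tk addnS ltnS leq_addr.
have sC j := xget_continuation j s st.
pose s' (j : 'I_(nscen M t)) := xget s (continuation j s).
have IH' j := IH t.+1 (s' j) isT (etrans (addSnnS _ _) tk).
have /choice[r rE] : forall j, exists r,
    nested_risk w y k t.+1 (s' j) = r%:E.
  by move=> j; have [] := IH' j.
have nestE : nested_risk w y k.+1 t s = risk (riskset M t)
    (fun j => (dot (cost M j) (y t (s' j)) + r j)%:E).
  rewrite nested_riskS; congr risk; apply/funext => j.
  by have [wj _] := sC j; rewrite /= -/(s' j) rE EFinD wj.
have QA := ambiguity_riskset M_wf st.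
split; last by rewrite nestE; exact: risk_fin.
rewrite primal_recS; apply: (@le_trans _ _ (recourse_risk (cost M)
    (riskset M t) (primal_rec M k t.+1)
    (fun j => x t (s' j)) (fun j => y t (s' j)))); last first.
  rewrite nestE; apply: le_risk_homo => // j.
  by rewrite EFinD leeD2l // -rE; exact: (IH' j).1.
apply: ereal_inf_lbound; do 2!eexists; split; last by [].
move=> j; have [_ _ /(_ (s' j))[eqn x0 xm y0 ym]] := xyF.2 t st.
have [wj wh] := sC j; rewrite -/(s' j) in wj wh.
split => //; last by apply: le_lt_trans (IH' j).1 _; rewrite rE ltry.
rewrite -(feasible_history xyF st wh).
by move: eqn; rewrite wj.
Qed.

(** All sets [B] can be allowed because decisions that depend on the past noises
    take finitely many values. *)
Definition history_measurable t (S : Type) (f : Omega -> S) : Prop :=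
  forall B : set S, <<s history_events w t >> (f @^-1` B).

Lemma history_measurable_adapted t n (f : Omega -> 'cV[R]_n) :
  history_measurable t f -> adapted w t f.
Proof.
move=> fm i _ Y _; rewrite setTI.
exact: (fm [set u | Y (u i 0)]).
Qed.

(** The supports are finite, so a decision taken on the past and the present
    noise splits along the finitely many values of the present noise. *)
Lemma history_measurable_step t (S S' : Type) (f : Omega -> S)
    (h : S -> 'I_(nscen M t.+1) -> S') : history_measurable t f ->
  history_measurable t.+1 (fun s => h (f s) (w t.+1 s)).
Proof.
move=> fm B.
have -> : (fun s => h (f s) (w t.+1 s)) @^-1` B =
    \bigcup_(j in [set: 'I_(nscen M t.+1)])
      ((w t.+1 @^-1` [set j]) `&` (f @^-1` [set a | B (h a j)])).
  apply/seteqP; split => [s Bs|s [j _ [/= <-]]] //.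
  by exists (w t.+1 s).
apply: (@fin_bigcup_measurable _ (g_sigma_algebraType (history_events w t.+1))).
  exact: finite_finset.
move=> j _; apply: measurableI.
  apply: sub_sigma_algebra; exists t.+1, [set j]; split => //.
  by rewrite leqnn.
apply: (sub_sigma_algebra2 _ (fm _)) => _ [k [A [/andP[k1 kt] ->]]].
by exists k, A; rewrite k1 (leq_trans kt).
Qed.

(** An optimal policy follows recourse decisions [X] that attain the value
    functions. *)
Section SelectedPolicy.
Variable X : forall t, 'cV[R]_(xdim M t) ->
  ('I_(nscen M t.+1) -> 'cV[R]_(xdim M t.+1)) *
  ('I_(nscen M t.+1) -> 'cV[R]_(ydim M t.+1)).

Fixpoint policy_state t : Omega -> 'cV[R]_(xdim M t) :=
  if t is t'.+1 then fun s => (X (policy_state t' s)).1 (w t'.+1 s)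
  else fun=> xinit M.

Definition policy_control t : Omega -> 'cV[R]_(ydim M t) :=
  if t is t'.+1 then fun s => (X (policy_state t' s)).2 (w t'.+1 s)
  else fun=> 0.

Lemma policy_state_measurable t : history_measurable t (policy_state t).
Proof.
elim: t => [|t IH].
  move=> B; have [Bx|nBx] := pselect (B (xinit M)).
    rewrite (_ : _ @^-1` _ = setT).
      exact: (@measurableT _ (g_sigma_algebraType (history_events w 0))).
    by apply/seteqP; split.
  rewrite (_ : _ @^-1` _ = set0); first exact: sigma_algebra0.
  by apply/seteqP; split.
exact: (history_measurable_step (fun a => (X a).1) IH).
Qed.

Lemma policy_control_measurable t :
  history_measurable t.+1 (policy_control t.+1).
Proof.
exact: (history_measurable_step (fun a => (X a).2)
  (@policy_state_measurable t)).
Qed.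

Hypothesis V1_fin : (primal_rec M (horizon M) 1 (xinit M) < +oo)%E.
Hypothesis X_opt : forall k t (x : 'cV[R]_(xdim M t)),
  (t + k.+1 = horizon M)%N -> (primal_rec M k.+1 t.+1 x < +oo)%E ->
  recourse_feasible (matA M) (matB M) (matT M) (rhs M) (xmax M t.+1)
    (ymax M t.+1) (primal_rec M k t.+2) x (X x).1 (X x).2 /\
  recourse_risk (cost M) (riskset M t.+1) (primal_rec M k t.+2)
    (X x).1 (X x).2 = primal_rec M k.+1 t.+1 x.

Lemma policy_value_fin k t s : (t + k = horizon M)%N ->
  (primal_rec M k t.+1 (policy_state t s) < +oo)%E.
Proof.
elim: t k => [|t IH] k tk; first by rewrite -[k]add0n tk.
have tk' : (t + k.+1 = horizon M)%N by rewrite -addSnnS.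
have [xy _] := X_opt tk' (IH _ tk').
by have [_ _ _] := xy (w t.+1 s).
Qed.

Lemma policy_feasible : feasible w policy_state policy_control.
Proof.
split => // -[|t] // st.
split; try apply: history_measurable_adapted.
- exact: policy_state_measurable.
- exact: policy_control_measurable.
move=> s; have tk : (t + (horizon M - t.+1).+1 = horizon M)%N.
  by rewrite -addSnnS subnKC //; case/andP: st.
have [xy _] := X_opt tk (policy_value_fin s tk).
by have [eqn [x0 xm] [y0 ym] _] := xy (w t.+1 s).
Qed.

Lemma policy_nested k t s : (1 <= t)%N -> (t + k = (horizon M).+1)%N ->
  nested_risk w policy_control k t s = primal_rec M k t (policy_state t.-1 s).
Proof.
elim: k t s => [//|k IH] [//|t] s _ tk.
have tk' : (t + k.+1 = horizon M)%N by move: tk; rewrite addSn => -[].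
have st := stageS tk'.
rewrite nested_riskS.
have [_ <-] := X_opt tk' (policy_value_fin s tk').
congr risk; apply/funext => j.
have [wj wh] := xget_continuation j s st.
have xs := feasible_history policy_feasible st wh.
rewrite /= IH //; last by rewrite addSnnS.
by move: xs wj => /= -> ->.
Qed.

End SelectedPolicy.

Lemma optimal_value_primal : (exists x y, feasible w x y) ->
  (primal_rec M (horizon M) 1 (xinit M) < +oo)%E /\
  optimal_value w = primal_rec M (horizon M) 1 (xinit M).
Proof.
move=> [x [y xyF]].
have lower x' y' : feasible w x' y' ->
    (primal_rec M (horizon M) 1 (xinit M) <= objective w y')%E /\
    exists r, objective w y' = r%:E.
  move=> xyF'; have := primal_rec_le_nested point xyF' (leqnn 1) (add1n _).
  by rewrite /= xyF'.1.
have V1_fin : (primal_rec M (horizon M) 1 (xinit M) < +oo)%E.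
  by have [le [r rE]] := lower _ _ xyF; apply: le_lt_trans le _; rewrite rE ltry.
split => //; apply/eqP; rewrite eq_le; apply/andP; split; last first.
  by apply: le_ereal_inf_tmp => _ [x' [y' [xyF' ->]]]; have [] := lower _ _ xyF'.
have sel t (x' : 'cV[R]_(xdim M t)) : exists X :
    ('I_(nscen M t.+1) -> 'cV[R]_(xdim M t.+1)) *
    ('I_(nscen M t.+1) -> 'cV[R]_(ydim M t.+1)),
    forall k, (t + k.+1 = horizon M)%N ->
    (primal_rec M k.+1 t.+1 x' < +oo)%E ->
    recourse_feasible (matA M) (matB M) (matT M) (rhs M) (xmax M t.+1)
      (ymax M t.+1) (primal_rec M k t.+2) x' X.1 X.2 /\
    recourse_risk (cost M) (riskset M t.+1) (primal_rec M k t.+2)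
      X.1 X.2 = primal_rec M k.+1 t.+1 x'.
  have [[k [tk Vx]]|nk] := pselect (exists k, (t + k.+1 = horizon M)%N /\
      (primal_rec M k.+1 t.+1 x' < +oo)%E); last first.
    by exists (fun=> 0, fun=> 0) => k tk Vx; case: nk; exists k.
  have dp := stage_dual_pair M_wf V1_fin (etrans (addSnnS t k) tk).
  have [v [xs [ys [Vv xy rE]]]] := primal_step_attained
    (ambiguity_riskset M_wf (stageS tk)) dp Vx.
  exists (xs, ys) => k' tk' _.
  have -> : k' = k by apply/succn_inj/(@addnI t); rewrite tk' tk.
  by split => //; rewrite primal_recS Vv.
pose X t x' := projT1 (cid (@sel t x')).
have XP k t x' := projT2 (cid (@sel t x')) k.
apply: ereal_inf_lbound; exists (policy_state X), (policy_control X).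
split; first exact: (policy_feasible V1_fin).
by rewrite /objective (policy_nested V1_fin).
Qed.

End Policies.

Theorem proposition5 (R : realType) (M : mslp R) (d : measure_display)
    (Omega : measurableType d) (P : probability Omega R)
    (w : forall t, Omega -> 'I_(nscen M t))
    (M_wf : mslp_wf M) (w_wf : noise_wf P w)
    (has_optimum : exists x y, optimal_solution w x y) :
  (forall t : nat, (1 <= t <= horizon M)%N ->
    [/\ forall (p : 'cV[R]_(xdim M t)) (gamma : R), 0 <= gamma ->
          dual_value M t p gamma =
          (- ereal_inf [set v | exists zeta psi : 'cV[R]_(xdim M t),
               [/\ p <=v zeta + psi, 0 <=v zeta
                 & v = (dot (xmax M t) zeta)%:E
                       + coperspective (primal_value M t.+1)
                           psi gamma]])%E,
        concave_on_nneg (dual_value M t),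
        pos_homogeneous_on_nneg (dual_value M t)
      & forall (p : 'cV[R]_(xdim M t)) (gamma : R), 0 <= gamma ->
          (- dual_value M t p gamma)%E =
          lipschitz_reg (xmax M t)
            (coperspective (primal_value M t.+1)) p gamma]) /\
  optimal_value w =
    ereal_sup [set ((dot p0 (xinit M))%:E + dual_value M 0%N p0 1%R)%E
              | p0 in [set: 'cV[R]_(xdim M 0)]].
Proof.
have [x [y [xyF _]]] := has_optimum.
have [V1_fin ->] := optimal_value_primal M_wf w_wf
  (ex_intro _ x (ex_intro _ y xyF)).
have dp t : (t <= horizon M)%N -> dual_pair (xmax M t)
    (primal_value M t.+1) (dual_value M t).
  move=> th; rewrite /primal_value subSS.
  by apply: stage_dual_pair => //; rewrite subnKC.
split => [t /andP[_ th]|].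
  have dpt := dp t th; split.
  - move=> p g g0; apply: oppe_inj; rewrite oppeK.
    exact/esym/(dp_lipschitz_reg dpt).
  - exact: dp_concave dpt.
  - exact: dp_pos_homogeneous dpt.
  - by move=> p g g0; rewrite (dp_lipschitz_reg dpt).
have := dp 0 (leq0n _); rewrite /primal_value subSS subn0 => dp0.
apply: (dp_biconjugate dp0) => //.
by split; [exact: xinit_ge0|exact: xinit_le].
Qed.
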